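(* Consider the iterates of sum-product GAMP (described in the context). Then for every $t$: (i) the updates for $\mathbf{x}^{t+1}$ and $\boldsymbol{\tau}_x^{t+1}$ are equivalent to $$(\mathbf{x}^{t+1},\boldsymbol{\tau}_x^{t+1})=\arg\min_{\bar{\mathbf{x}},\bar{\boldsymbol{\tau}}_x}\Big[L_{\rm SP}(\bar{\mathbf{x}},\mathbf{z}^t,\bar{\boldsymbol{\tau}}_x,\boldsymbol{\tau}_p^t,\mathbf{s}^t)+\tfrac12(\boldsymbol{\tau}_s^t)^T\mathbf{S}\bar{\boldsymbol{\tau}}_x+\tfrac12\|\bar{\mathbf{x}}-\mathbf{x}^t\|^2_{\boldsymbol{\tau}_r^t}\Big];$$ (ii) the updates yielding $\boldsymbol{\tau}_p^t,\mathbf{z}^t,\mathbf{s}^t,\boldsymbol{\tau}_s^t$ are equivalent to $\boldsymbol{\tau}_p^t=\mathbf{S}\boldsymbol{\tau}_x^t$, $\mathbf{z}^t=\arg\min_{\bar{\mathbf{z}}}\big[L_{\rm SP}(\mathbf{x}^t,\bar{\mathbf{z}},\boldsymbol{\tau}_x^t,\boldsymbol{\tau}_p^t,\mathbf{s}^{t-1})+\tfrac12\|\bar{\mathbf{z}}-\mathbf{A}\mathbf{x}^t\|^2_{\boldsymbol{\tau}_p^t}\big]$, $\mathbf{s}^t=\mathbf{s}^{t-1}+\frac{1}{\boldsymbol{\tau}_p^t}(\mathbf{z}^t-\mathbf{A}\mathbf{x}^t)$, $\boldsymbol{\tau}_s^t=2\frac{\partial}{\partial\boldsymbol{\tau}_p}L_{\rm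 SP}(\mathbf{x}^t,\mathbf{z}^t,\boldsymbol{\tau}_x^t,\boldsymbol{\tau}_p^t,\mathbf{s}^t)$. Moreover, any fixed point $(\hat{\mathbf{x}},\hat{\mathbf{z}},\boldsymbol{\tau}_x,\boldsymbol{\tau}_p,\mathbf{s})$ of sum-product GAMP is a critical point of the optimization $\min F_{\rm SP}(\bar{\mathbf{x}},\bar{\mathbf{z}},\bar{\boldsymbol{\tau}}_x,\bar{\boldsymbol{\tau}}_p)$ s.t. $\bar{\mathbf{z}}=\mathbf{A}\bar{\mathbf{x}}$, $\bar{\boldsymbol{\tau}}_p=\mathbf{S}\bar{\boldsymbol{\tau}}_x$ with Lagrangian $L_{\rm SP}$: namely $\hat{\mathbf{z}}=\mathbf{A}\hat{\mathbf{x}}$, $\boldsymbol{\tau}_p=\mathbf{S}\boldsymbol{\tau}_x$, and the function $(\bar{\mathbf{x}},\bar{\mathbf{z}},\bar{\boldsymbol{\tau}}_x)\mapsto L_{\rm SP}(\bar{\mathbf{x}},\bar{\mathbf{z}},\bar{\boldsymbol{\tau}}_x,\mathbf{S}\bar{\boldsymbol{\tau}}_x,\mathbf{s})$ has zero partial derivatives in $\bar{\mathbf{x}},\bar{\mathbf{z}},\bar{\boldsymbol{\tau}}_x$ at $(\hat{\mathbf{x}},\hat{\mathbf{z}},\boldsymbol{\tau}_x)$. In addition, the densities attaining the minima defining $F^x_{\rm SP}$ and $F^z_{\rm SP}$ (at the corresponding arguments $(\mathbf{x},\boldsymbol{\tau}_x)$ and $(\mathbf{z},\boldsymbol{\tau}_p)$)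 are $\hat b_x(\mathbf{x})=p(\mathbf{x}|\mathbf{r},\boldsymbol{\tau}_r)$ and $\hat b_z(\mathbf{z})=p(\mathbf{z}|\mathbf{p},\boldsymbol{\tau}_p)$.
   Context: All vector-vector products, quotients and inverses are componentwise; for positive $\boldsymbol{\tau}$, $\|\mathbf{v}\|^2_{\boldsymbol{\tau}}:=\sum_i|v_i|^2/\tau_i$. $\mathbf{A}\in\mathbb{R}^{m\times n}$, $\mathbf{S}:=|\mathbf{A}|^2$ (entrywise), $f_x(\mathbf{x})=\sum_j f_{x_j}(x_j)$, $f_z(\mathbf{z})=\sum_i f_{z_i}(z_i)$. Define densities $p(\mathbf{x}|\mathbf{r},\boldsymbol{\tau}_r)\propto\prod_{j}\exp[-f_{x_j}(x_j)-|x_j-r_j|^2/(2\tau_{r_j})]$ and $p(\mathbf{z}|\mathbf{p},\boldsymbol{\tau}_p)\propto\prod_i\exp[-f_{z_i}(z_i)-|z_i-p_i|^2/(2\tau_{p_i})]$, assumed normalizable; $\mathbb{E}(\cdot|\cdot)$ and $\mathrm{var}(\cdot|\cdot)$ denote mean and componentwise-variance vectors under them. Sum-product GAMP: initialize $\mathbf{x}^0$, positive $\boldsymbol{\tau}_x^0$, $\mathbf{s}^{-1}=\mathbf{0}$. For $t=0,1,\dots$: $\boldsymbol{\tau}_p^t=\mathbf{S}\boldsymbol{\tau}_x^t$; $\mathbf{p}^t=\mathbf{A}\mathbf{x}^t-\mathbf{s}^{t-1}\boldsymbol{\tau}_p^t$; $\mathbf{z}^t=\mathbb{E}(\mathbf{z}|\mathbf{p}^t,\boldsymbol{\tau}_p^t)$;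 $\boldsymbol{\tau}_z^t=\mathrm{var}(\mathbf{z}|\mathbf{p}^t,\boldsymbol{\tau}_p^t)$; $\mathbf{s}^t=(\mathbf{z}^t-\mathbf{p}^t)/\boldsymbol{\tau}_p^t$; $\boldsymbol{\tau}_s^t=1/\boldsymbol{\tau}_p^t-\boldsymbol{\tau}_z^t/(\boldsymbol{\tau}_p^t)^2$; $\boldsymbol{\tau}_r^t=1/(\mathbf{S}^T\boldsymbol{\tau}_s^t)$; $\mathbf{r}^t=\mathbf{x}^t+\boldsymbol{\tau}_r^t\mathbf{A}^T\mathbf{s}^t$; $\mathbf{x}^{t+1}=\mathbb{E}(\mathbf{x}|\mathbf{r}^t,\boldsymbol{\tau}_r^t)$; $\boldsymbol{\tau}_x^{t+1}=\mathrm{var}(\mathbf{x}|\mathbf{r}^t,\boldsymbol{\tau}_r^t)$ (all quantities assumed well defined and positive where required). A fixed point is a set of values left unchanged by an iteration. Objects: for a density $b$, $D(b\|e^{-f}):=\int b\log(b/e^{-f})$; densities range over product densities. $H_{\rm gauss}(b_z,\bar{\boldsymbol{\tau}}_p):=\sum_{i=1}^m[\frac{1}{2\bar\tau_{p_i}}\mathrm{var}(z_i|b_{z_i})+\frac12\log(2\pi\bar\tau_{p_i})]$. $F^x_{\rm SP}(\bar{\mathbf{x}},\bar{\boldsymbol{\tau}}_x):=\min_{b_x}D(b_x\|e^{-f_x})$ s.t. $\mathbb{E}(\mathbf{x}|b_x)=\bar{\mathbf{x}}$, $\mathrm{var}(\mathbf{x}|b_x)=\bar{\boldsymbol{\tau}}_x$;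 $F^z_{\rm SP}(\bar{\mathbf{z}},\bar{\boldsymbol{\tau}}_p):=\min_{b_z}[D(b_z\|e^{-f_z})+H_{\rm gauss}(b_z,\bar{\boldsymbol{\tau}}_p)]$ s.t. $\mathbb{E}(\mathbf{z}|b_z)=\bar{\mathbf{z}}$; $F_{\rm SP}:=F^x_{\rm SP}(\bar{\mathbf{x}},\bar{\boldsymbol{\tau}}_x)+F^z_{\rm SP}(\bar{\mathbf{z}},\bar{\boldsymbol{\tau}}_p)$; and the Lagrangian $L_{\rm SP}(\bar{\mathbf{x}},\bar{\mathbf{z}},\bar{\boldsymbol{\tau}}_x,\bar{\boldsymbol{\tau}}_p,\bar{\mathbf{s}}):=F_{\rm SP}(\bar{\mathbf{x}},\bar{\mathbf{z}},\bar{\boldsymbol{\tau}}_x,\bar{\boldsymbol{\tau}}_p)+\bar{\mathbf{s}}^T(\bar{\mathbf{z}}-\mathbf{A}\bar{\mathbf{x}})$. *)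

(* Defs.v *)
From HB Require Import structures.
From mathcomp Require Import all_boot all_order all_algebra.
From mathcomp Require Import all_classical all_reals all_analysis.
Set Implicit Arguments. Unset Strict Implicit. Unset Printing Implicit Defensive.
Import Order.TTheory GRing.Theory Num.Theory.
Import numFieldNormedType.Exports.
Local Open Scope classical_set_scope.
Local Open Scope ring_scope.

Section GAMPDefs.
Variable R : realType.

Definition leb := (@lebesgue_measure R).

Definition RI (f : R -> R) : R := Rintegral leb setT f.
Definition integrableR (f : R -> R) : Prop := leb.-integrable setT (EFin \o f).

Definition is_density (b : R -> R) : Prop :=
  measurable_fun setT b /\ (forall x, 0 <= b x) /\ integrableR b /\ RI b = 1.

Definition dmean (b : R -> R) : R := RI (fun x => x * b x).
Definition dvar (b : R -> R) : R := RI (fun x => (x - dmean b) ^+ 2 * b x).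

(* integrand of D(b || e^{-f}) = int b log (b / e^{-f}) = int b (log b + f) *)
Definition KLint (b f : R -> R) : R -> R := fun x => b x * (ln (b x) + f x).
Definition KL (b f : R -> R) : R := RI (KLint b f).

(* densities for which D(b||e^{-f}), the mean and the variance are well defined *)
Definition admissible (b f : R -> R) : Prop :=
  is_density b /\ integrableR (KLint b f) /\
  integrableR (fun x => x * b x) /\ integrableR (fun x => x ^+ 2 * b x).

Definition qdens (f : R -> R) (r tau : R) : R -> R :=
  fun x => expR (- f x - (x - r) ^+ 2 / (2 * tau)).
Definition pdens (f : R -> R) (r tau : R) : R -> R :=
  fun x => qdens f r tau x / RI (qdens f r tau).
Definition pmean f r tau := dmean (pdens f r tau).
Definition pvar f r tau := dvar (pdens f r tau).

Definition Smat (m n : nat) (A : 'M[R]_(m, n)) : 'M[R]_(m, n) :=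
  \matrix_(i, j) (A i j ^+ 2).
Definition mv (m n : nat) (A : 'M[R]_(m, n)) (x : 'I_n -> R) : 'I_m -> R :=
  fun i => \sum_j A i j * x j.
Definition mtv (m n : nat) (A : 'M[R]_(m, n)) (y : 'I_m -> R) : 'I_n -> R :=
  fun j => \sum_i A i j * y i.

(* vector versions of E(.|r,tau) and var(.|r,tau) for separable f *)
Definition Evec (k : nat) (f : 'I_k -> R -> R) (r tau : 'I_k -> R) : 'I_k -> R :=
  fun j => pmean (f j) (r j) (tau j).
Definition Vvec (k : nat) (f : 'I_k -> R -> R) (r tau : 'I_k -> R) : 'I_k -> R :=
  fun j => pvar (f j) (r j) (tau j).

(* D(b || e^{-f}) for a product density b = prod_j b_j *)
Definition KLvec (k : nat) (b : 'I_k -> R -> R) (f : 'I_k -> R -> R) : R :=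
  \sum_j KL (b j) (f j).

Definition Hgauss (m : nat) (b : 'I_m -> R -> R) (taup : 'I_m -> R) : R :=
  \sum_i (dvar (b i) / (2 * taup i) + ln (2 * pi * taup i) / 2).

Definition Fx_feasible (n : nat) (fx : 'I_n -> R -> R) (xb tx : 'I_n -> R)
  (b : 'I_n -> R -> R) : Prop :=
  forall j, admissible (b j) (fx j) /\ dmean (b j) = xb j /\ dvar (b j) = tx j.
Definition FxSP (n : nat) (fx : 'I_n -> R -> R) (xb tx : 'I_n -> R) : \bar R :=
  ereal_inf [set (KLvec b fx)%:E | b in Fx_feasible fx xb tx].

Definition Fz_feasible (m : nat) (fz : 'I_m -> R -> R) (zb : 'I_m -> R)
  (b : 'I_m -> R -> R) : Prop :=
  forall i, admissible (b i) (fz i) /\ dmean (b i) = zb i.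
Definition FzSP (m : nat) (fz : 'I_m -> R -> R) (zb tp : 'I_m -> R) : \bar R :=
  ereal_inf [set (KLvec b fz + Hgauss b tp)%:E | b in Fz_feasible fz zb].

Definition FSP m n fx fz (xb : 'I_n -> R) (zb : 'I_m -> R) tx tp : \bar R :=
  (FxSP fx xb tx + FzSP fz zb tp)%E.

Definition LSP (m n : nat) (A : 'M[R]_(m, n)) fx fz
  (xb : 'I_n -> R) (zb : 'I_m -> R) (tx : 'I_n -> R) (tp : 'I_m -> R)
  (s : 'I_m -> R) : \bar R :=
  (FSP fx fz xb zb tx tp + (\sum_i s i * (zb i - mv A xb i))%:E)%E.

Definition slice (k : nat) (G : ('I_k -> R) -> R) (v : 'I_k -> R) (j : 'I_k)
  : R -> R := fun h => G (fun l => if l == j then v l + h else v l).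
Definition pderivable k (G : ('I_k -> R) -> R) v j : Prop :=
  derivable (slice G v j) 0 1.
Definition pderiv k (G : ('I_k -> R) -> R) v j : R := derive1 (slice G v j) 0.

Definition sprev (m : nat) (s : nat -> 'I_m -> R) (t : nat) : 'I_m -> R :=
  fun i => match t with 0%N => 0 | t'.+1 => s t' i end.

Definition objx (m n : nat) (A : 'M[R]_(m, n)) fx fz (xt : 'I_n -> R)
  (zt tpt st tst : 'I_m -> R) (trt : 'I_n -> R) (xb tb : 'I_n -> R) : \bar R :=
  (LSP A fx fz xb zt tb tpt st
   + (1 / 2 * \sum_i tst i * mv (Smat A) tb i)%:E
   + (1 / 2 * \sum_j (xb j - xt j) ^+ 2 / trt j)%:E)%E.

Definition objz (m n : nat) (A : 'M[R]_(m, n)) fx fz (xt tx : 'I_n -> R)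
  (tpt spt : 'I_m -> R) (zb : 'I_m -> R) : \bar R :=
  (LSP A fx fz xt zb tx tpt spt
   + (1 / 2 * \sum_i (zb i - mv A xt i) ^+ 2 / tpt i)%:E)%E.

(* fixed point of sum-product GAMP: the state (xh, tx, sh) together with the
   intermediate quantities it produces, such that one iteration leaves all
   values unchanged *)

Definition sp_fixed_point (m n : nat) (A : 'M[R]_(m, n)) fx fz
  (xh tx : 'I_n -> R) (sh : 'I_m -> R) (tp p zh tz s' ts : 'I_m -> R)
  (tr r : 'I_n -> R) : Prop :=
  tp = mv (Smat A) tx /\
  p = (fun i => mv A xh i - sh i * tp i) /\
  zh = Evec fz p tp /\ tz = Vvec fz p tp /\
  s' = (fun i => (zh i - p i) / tp i) /\
  ts = (fun i => 1 / tp i - tz i / tp i ^+ 2) /\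
  tr = (fun j => 1 / mtv (Smat A) ts j) /\
  r = (fun j => xh j + tr j * mtv A s' j) /\
  s' = sh /\ Evec fx r tr = xh /\ Vvec fx r tr = tx.

End GAMPDefs.

(* Main.v *)
(* Relative to p = p(.|r, tau), the divergence D(b || e^{-f}) plus the Gaussian
   term (var b + (E b - r)^2) / (2 tau) equals KL(b || p) - ln Z. Hence, after
   completing the square, both updates minimize a nonnegative divergence, which
   vanishes exactly at p. Since the infima defining F_SP at other arguments need
   not be attained, uniqueness of the minimizing moments uses the stronger bound
   KL(b || p) >= lam (E_b phi - E_p phi) - C lam^2 for small lam, obtained by
   comparing b with the tilted density p e^{lam phi}, for phi = x - r and
   phi = (x - r)^2. Derivatives of F_SP are found by squeezing: the
   nonnegativity of KL and the tilted bound give differentiable minorants, and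
   densities p (1 + g), with g a bounded truncated quadratic realizing a
   prescribed small change of moments at cost O(|g|^2), give majorants with the
   same value and slope. *)
Require Import Defs.
From HB Require Import structures.
From mathcomp Require Import all_boot all_order all_algebra.
From mathcomp Require Import all_classical all_reals all_analysis.
From mathcomp Require Import measurable_realfun ring lra.
Import Order.TTheory GRing.Theory Num.Theory.
Import numFieldNormedType.Exports.
Set Implicit Arguments. Unset Strict Implicit. Unset Printing Implicit Defensive.
Local Open Scope classical_set_scope.
Local Open Scope ring_scope.

(** * Integrals *)

(** Apart from measurability, all that is known of [f] is that each of its Gaussian tilts is
    normalizable, so growth control must come from there: integrability at width [2 * tau] says that
    [expR ((x - r)^2 / (4 * tau))] has finite mean under [p(.|r, tau)], which pays for polynomial
    moments, for linear tilts, and for a quadratic tilt at half that rate. The constants of the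
    tilted bound do not depend on [b]; this is why it survives an infimum that has no minimizer. It
    is needed even for the slope in [tau_p]: only the mean is constrained there, so [var b], the
    coefficient of the perturbed [1 / (2 tau_p)], is uncontrolled, and nonnegativity of the
    divergence alone gives no minorant. A separate obstacle is the start of the iteration. The pair
    [(x^0, tau_x^0)] is arbitrary, so finiteness of [F^x_SP] there is not automatic; were it
    infinite, the [z] objective at [t = 0] would be infinite everywhere and its minimizer would not
    be unique. Densities with prescribed mean and variance are therefore constructed for a general
    measurable [f]. *)

Section Integration.
Context {R : realType}.
Implicit Types (f g : R -> R) (a b u v : R).

(** [RI] has a value on every function but is linear only on integrable ones; carrying both facts
    together lets moments be computed by algebra. *)
Definition hasI f v := integrableR f /\ RI f = v.

Lemma hasI_RI f : integrableR f -> hasI f (RI f).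
Proof. by split. Qed.

Lemma hasI_eq f g u v : hasI f u -> f =1 g -> u = v -> hasI g v.
Proof. by move=> hf /funext <- <-. Qed.

Lemma hasI_integrable f g u : hasI f u -> f =1 g -> integrableR g.
Proof. by move=> [If _] /funext <-. Qed.

Lemma hasID f g u v : hasI f u -> hasI g v -> hasI (fun x => f x + g x) (u + v).
Proof.
move=> [If <-] [Ig <-]; split.
  exact: (integrableD measurableT If Ig).
exact: RintegralD.
Qed.

Lemma hasIZ c f u : hasI f u -> hasI (fun x => c * f x) (c * u).
Proof.
move=> [If <-]; split; last exact: RintegralZl.
exact: (integrableZl measurableT c If).
Qed.

Lemma hasIB f g u v : hasI f u -> hasI g v -> hasI (fun x => f x - g x) (u - v).
Proof.
move=> hf hg; apply: (hasI_eq (hasID hf (hasIZ (-1) hg))) => [x|]; lra.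
Qed.

Lemma hasI_unique f u v : hasI f u -> hasI f v -> u = v.
Proof. by move=> [_ <-] [_ <-]. Qed.

Lemma hasI_le f g u v : hasI f u -> hasI g v -> (forall x, f x <= g x) -> u <= v.
Proof. by move=> [If <-] [Ig <-] fg; apply: le_Rintegral. Qed.

Lemma integrableR_measurable f : integrableR f -> measurable_fun setT f.
Proof. by move=> /measurable_int/measurable_EFinP. Qed.

Lemma integrableR_dom f g : measurable_fun setT f -> integrableR g ->
  (forall x, `|f x| <= g x) -> integrableR f.
Proof.
move=> mf Ig fg; apply: (le_integrable measurableT _ _ Ig).
  exact/measurable_EFinP.
by move=> x _; rewrite /= lee_fin (le_trans (fg x))// ler_norm.
Qed.

Lemma hasI_ae0 f : (forall x, 0 <= f x) -> hasI f 0 -> {ae @leb R, forall x, f x = 0}.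
Proof.
move=> f0 [If RIf].
have mf : measurable_fun setT (EFin \o f).
  by case/integrableP: If.
have : (\int[@leb R]_x `|(EFin \o f) x| = 0)%E.
  transitivity (\int[@leb R]_x (f x)%:E)%E.
    by apply: eq_integral => x _ /=; rewrite ger0_norm.
  have : (\int[@leb R]_x (f x)%:E)%E \is a fin_num.
    exact: (integrable_fin_num measurableT If).
  by move=> /fineK <-; rewrite -[RHS]/(0%:E) -RIf.
move/(iffLR (ae_eq_integral_abs lebesgue_measure measurableT mf)).
apply: filterS => x /(_ I) /=.
by move=> [].
Qed.

Lemma ae_imp (P Q : R -> Prop) : (forall x, P x -> Q x) ->
  {ae @leb R, forall x, P x} -> {ae @leb R, forall x, Q x}.
Proof.
move=> PQ; rewrite /leb => aeP.
exact: (@filterS _ _ (ae_filter_ringOfSetsType lebesgue_measure) P Q).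
Qed.

(** A null set cannot contain a nonempty open interval. This turns almost-everywhere facts into
    actual points. *)
Lemma ae_exists_itv (P : R -> Prop) a b : a < b -> {ae @leb R, forall x, P x} ->
  exists2 x, a < x < b & P x.
Proof.
move=> ab [N [mN N0 PN]]; apply: contrapT => nex.
have sub : `]a, b[%classic `<=` N.
  move=> x /=; rewrite in_itv /= => abx; apply: PN => /= Px.
  by apply: nex; exists x.
have : (lebesgue_measure (`]a, b[%classic : set R) <= 0)%E.
  rewrite -[leRHS]N0; apply: (le_measure lebesgue_measure _ _ sub).
    by apply: mem_set; exact: measurable_itv.
  by apply: mem_set.
by rewrite lebesgue_measure_itv /= lte_fin ab -EFinB lee_fin subr_le0 leNgt ab.
Qed.

Lemma hasI_ge0 f u : (forall x, 0 <= f x) -> hasI f u -> 0 <= u.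
Proof. by move=> f0 [_ <-]; apply: Rintegral_ge0. Qed.

Lemma hasI_gt0 f u : (forall x, 0 <= f x) ->
  (exists a b, a < b /\ forall x, a < x < b -> 0 < f x) -> hasI f u -> 0 < u.
Proof.
move=> f0 [a [b [ab fab]]] If.
have u0 : 0 <= u by exact: hasI_ge0 If.
rewrite lt_neqAle u0 andbT; apply/eqP => u00.
rewrite -u00 in If; have [x abx] := ae_exists_itv ab (hasI_ae0 f0 If).
by move=> fx0; have := fab x abx; rewrite fx0 ltxx.
Qed.

End Integration.

(** * Exponential families *)

Ltac measurability :=
  repeat first
    [ assumption
    | exact: measurable_cst | exact: measurable_id
    | exact: measurable_expR | exact: measurable_ln
    | apply: measurable_funB | apply: measurable_funD | apply: measurable_funM
    | apply: measurable_funX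
    | apply: (measurableT_comp (@measurable_expR _))
    | apply: (measurableT_comp (@measurable_ln _))
    | apply: (measurableT_comp (@normr_measurable _ _))
    | apply: (measurableT_comp (@oppr_measurable _ _)) ].

Section ElementaryInequalities.
Context {R : realType}.
Implicit Types (t u w y : R).

Lemma ln_le_subr1 t : 0 < t -> ln t <= t - 1.
Proof.
by move=> t0; have := expR_ge1Dx (ln t); rewrite lnK ?posrE// => ?; lra.
Qed.

Lemma ln_ge_1subV t : 0 < t -> 1 - t^-1 <= ln t.
Proof.
move=> t0; have := @ln_le_subr1 t^-1; rewrite invr_gt0 lnV ?posrE// => /(_ t0).
by move=> ?; lra.
Qed.

(** The remainder carries [expR |u|] because [u] will be an unbounded statistic times a small
    parameter. Everything follows from [expR v <= 1 + v * expR v], which is [expR (- v) >= 1 - v]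
    multiplied by [expR v]. *)
Lemma expR_le_quadratic u : expR u <= 1 + u + u ^+ 2 * expR `|u|.
Proof.
have uexp (v : R) : expR v <= 1 + v * expR v.
  have := expR_ge1Dx (- v); have := expRxMexpNx_1 v; have := expR_gt0 v.
  move: (expR v) (expR (- v)) => a b a0 ab1 b1; nra.
have := uexp u; have := expR_ge1Dx u; have := expR_gt0 u.
have [u0|u0] := leP 0 u.
  by rewrite ger0_norm//; move: (expR u) => a a0 a1 a2; nra.
have : 1 <= expR `|u| by rewrite -expR0 ler_expR.
by move: (expR u) (expR _) => a b b1 a0 a1 a2; nra.
Qed.

(** Gibbs' inequality before integration. As [w] need not have mass one, it also applies to
    unnormalized tilted densities. *)
Lemma entropy_pointwise y w : 0 <= y -> 0 < w -> y - w <= y * (ln y - ln w).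
Proof.
rewrite le_eqVlt => /predU1P[<-|y0] w0; first by rewrite mul0r; lra.
have := @ln_le_subr1 (w / y); rewrite ln_div ?posrE// divr_gt0// => /(_ isT) H.
have : y * (ln w - ln y) <= y * (w / y - 1) by rewrite ler_pM2l.
have -> : y * (w / y - 1) = w - y by field; rewrite gt_eqF.
have -> : y * (ln y - ln w) = - (y * (ln w - ln y)) by ring.
by move=> ?; lra.
Qed.

Lemma entropy_pointwise_eq y w : 0 <= y -> 0 < w ->
  y * (ln y - ln w) = y - w -> y = w.
Proof.
rewrite le_eqVlt => /predU1P[<-|y0] w0; first by rewrite mul0r; lra.
have wy0 : 0 < w / y by rewrite divr_gt0.
have [lnwy|lnwy] := eqVneq (ln (w / y)) 0.
  by move=> _; apply/esym; apply: ln_inj; rewrite ?posrE//; apply/eqP;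
    rewrite -subr_eq0 -ln_div ?posrE// lnwy.
have := expR_gt1Dx lnwy; rewrite lnK ?posrE// ln_div ?posrE// => H.
have : y * (1 + (ln w - ln y)) < y * (w / y) by rewrite ltr_pM2l.
have -> : y * (w / y) = w by field; rewrite gt_eqF.
by move=> ? E; nra.
Qed.

End ElementaryInequalities.

Section ExponentialFamily.
Context {R : realType}.
Variables (f : R -> R) (r tau : R).
Hypotheses (f_norm : forall r tau : R, 0 < tau -> integrableR (qdens f r tau))
  (tau0 : 0 < tau).

Local Notation q := (qdens f r tau).
Local Notation p := (pdens f r tau).
Local Notation Z := (RI (qdens f r tau)).

Lemma qdens_gt0 x : 0 < q x. Proof. exact: expR_gt0. Qed.

Lemma measurable_qdens : measurable_fun setT q.
Proof. exact: integrableR_measurable (f_norm r tau0). Qed.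

Lemma partition_gt0 : 0 < Z.
Proof.
apply: (hasI_gt0 (f := q)) => [x||]; first exact/ltW/qdens_gt0.
  by exists 0, 1; split => // x _; exact: qdens_gt0.
exact/hasI_RI/f_norm.
Qed.

Lemma pdens_gt0 x : 0 < p x.
Proof. by rewrite divr_gt0 ?qdens_gt0 ?partition_gt0. Qed.

Lemma measurable_pdens : measurable_fun setT p.
Proof. by have := measurable_qdens; move=> ?; rewrite /pdens; measurability. Qed.

Lemma ln_pdens x : ln (p x) = - f x - (x - r) ^+ 2 / (2 * tau) - ln Z.
Proof. by rewrite ln_div ?posrE ?qdens_gt0 ?partition_gt0// expRK. Qed.

Lemma hasI_pdens : hasI p 1.
Proof.
apply: (hasI_eq (hasIZ Z^-1 (hasI_RI (f_norm r tau0)))) => [x|].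
  by rewrite mulrC.
by rewrite mulVf// gt_eqF// partition_gt0.
Qed.

(** Doubling the width multiplies [q] by exactly [expR ((x - r)^2 / (4 * tau))], so normalizability
    at [2 * tau] supplies the dominating function. *)
Lemma integrableR_pdens_growth (phi : R -> R) C : measurable_fun setT phi ->
  (forall x, `|phi x| <= C * expR ((x - r) ^+ 2 / (4 * tau))) ->
  integrableR (fun x => phi x * p x).
Proof.
move=> mphi phiC; have tau20 : 0 < 2 * tau by rewrite mulr_gt0.
have mp := measurable_pdens.
have [I2 _] := hasIZ (C / Z) (hasI_RI (f_norm r tau20)).
apply: (integrableR_dom _ I2); first by measurability.
move=> x; rewrite normrM (gtr0_norm (pdens_gt0 x)).
have -> : C / Z * qdens f r (2 * tau) x =
    C * expR ((x - r) ^+ 2 / (4 * tau)) * p x.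
  have -> : qdens f r (2 * tau) x = expR ((x - r) ^+ 2 / (4 * tau)) * q x.
    by rewrite -expRD; congr expR; field; rewrite gt_eqF.
  by rewrite /pdens; ring.
by rewrite ler_pM2r// pdens_gt0.
Qed.

Lemma growth_sqr x :
  (x - r) ^+ 2 <= 8 * tau * expR ((x - r) ^+ 2 / (8 * tau)).
Proof.
have := expR_ge1Dx ((x - r) ^+ 2 / (8 * tau)) => H.
have t8 : 0 < 8 * tau by rewrite mulr_gt0.
apply: (@le_trans _ _ (8 * tau * ((x - r) ^+ 2 / (8 * tau)))); last first.
  by rewrite ler_pM2l//; lra.
by rewrite mulrCA divff ?gt_eqF// mulr1.
Qed.

Lemma expR_growth_double x : expR ((x - r) ^+ 2 / (4 * tau)) =
  expR ((x - r) ^+ 2 / (8 * tau)) * expR ((x - r) ^+ 2 / (8 * tau)).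
Proof. by rewrite -expRD; congr expR; field; rewrite gt_eqF. Qed.

Lemma expR_growth_ge1 x : 1 <= expR ((x - r) ^+ 2 / (8 * tau)).
Proof. by rewrite -expR0 ler_expR divr_ge0 ?sqr_ge0// mulr_ge0// ltW. Qed.

(** Half of the allowed exponent absorbs the square, the other half the exponential; the latter by
    completing the square at [|x - r| = 4 * tau]. *)
Lemma growth_linear_tilt x :
  (x - r) ^+ 2 * expR (1 * `|x - r|) <=
  8 * tau * expR (2 * tau) * expR ((x - r) ^+ 2 / (4 * tau)).
Proof.
have t8 : 0 < 8 * tau by rewrite mulr_gt0.
have H : expR (1 * `|x - r|) <= expR (2 * tau) * expR ((x - r) ^+ 2 / (8 * tau)).
  rewrite -expRD ler_expR mul1r -subr_ge0 -[(x - r) ^+ 2]real_normK ?num_real//.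
  set a := `|x - r|.
  have -> : 2 * tau + a ^+ 2 / (8 * tau) - a = (a - 4 * tau) ^+ 2 / (8 * tau).
    by field; rewrite gt_eqF.
  by rewrite divr_ge0 ?sqr_ge0// ltW.
have G := growth_sqr x; rewrite expR_growth_double.
have -> : 8 * tau * expR (2 * tau) * (expR ((x - r) ^+ 2 / (8 * tau)) *
    expR ((x - r) ^+ 2 / (8 * tau))) = 8 * tau * expR ((x - r) ^+ 2 / (8 * tau)) *
    (expR (2 * tau) * expR ((x - r) ^+ 2 / (8 * tau))) by ring.
by apply: ler_pM; rewrite ?sqr_ge0 ?expR_ge0.
Qed.

(** The rate [(8 * tau)^-1] spends half of the allowed exponent on the tilt; the other half absorbs
    the fourth power through [u^2 <= 2 * expR u]. *)
Lemma growth_quadratic_tilt x :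
  ((x - r) ^+ 2) ^+ 2 * expR ((8 * tau)^-1 * `|(x - r) ^+ 2|) <=
  2 * (8 * tau) ^+ 2 * expR ((x - r) ^+ 2 / (4 * tau)).
Proof.
have t8 : 0 < 8 * tau by rewrite mulr_gt0.
rewrite ger0_norm ?sqr_ge0// [(8 * tau)^-1 * _]mulrC expR_growth_double mulrA.
rewrite ler_pM2r ?expR_gt0//.
set u := (x - r) ^+ 2 / (8 * tau).
have -> : ((x - r) ^+ 2) ^+ 2 = (8 * tau) ^+ 2 * u ^+ 2.
  by rewrite /u; field; rewrite gt_eqF.
have u0 : 0 <= u by rewrite divr_ge0 ?sqr_ge0// ltW.
have := expR_ge1Dxn 1 u0; rewrite (_ : 2`!%:R = 2)// => H.
have -> : 2 * (8 * tau) ^+ 2 * expR u = (8 * tau) ^+ 2 * (2 * expR u) by ring.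
by rewrite ler_pM2l ?exprn_gt0//; lra.
Qed.

Lemma growth_poly x : `|(x - r) ^+ 2| <= (8 * tau + 1) * expR ((x - r) ^+ 2 / (4 * tau))
  /\ `|x - r| <= (8 * tau + 1) * expR ((x - r) ^+ 2 / (4 * tau)).
Proof.
rewrite expR_growth_double; have := expR_growth_ge1 x; have := growth_sqr x.
rewrite [`|(x - r) ^+ 2|]ger0_norm ?sqr_ge0// -[(x - r) ^+ 2]real_normK ?num_real//.
move: (normr_ge0 (x - r)); set a := `|_|; set e := expR _ => a0 G e1.
have He : 8 * tau * e <= 8 * tau * (e * e).
  by rewrite ler_pM2l ?mulr_gt0//; nra.
by split; nra.
Qed.

Lemma hasI_centered_pdens :
  hasI (fun x => (x - r) * p x) (RI (fun x => (x - r) * p x)) /\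
  hasI (fun x => (x - r) ^+ 2 * p x) (RI (fun x => (x - r) ^+ 2 * p x)).
Proof.
split; apply: hasI_RI; apply: (integrableR_pdens_growth (C := 8 * tau + 1)).
- by measurability.
- by move=> x; case: (growth_poly x).
- by measurability.
- by move=> x; case: (growth_poly x).
Qed.

End ExponentialFamily.

Section Admissible.
Context {R : realType}.
Implicit Types (f b : R -> R).

Lemma dvar_moments b : hasI b 1 -> integrableR (fun x => x * b x) ->
  integrableR (fun x => x ^+ 2 * b x) ->
  forall c, hasI (fun x => (x - c) ^+ 2 * b x) (dvar b + (dmean b - c) ^+ 2).
Proof.
move=> b1 /hasI_RI; rewrite -[RI _]/(dmean b) => bx /hasI_RI bxx.
set m2 := RI _ in bxx.
have H c : hasI (fun x => (x - c) ^+ 2 * b x) (m2 + (- 2 * c) * dmean b + c ^+ 2 * 1).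
  apply: (hasI_eq (hasID (hasID bxx (hasIZ (- 2 * c) bx)) (hasIZ (c ^+ 2) b1))) => //.
  by move=> x; ring.
have -> : dvar b = m2 + (- 2 * dmean b) * dmean b + dmean b ^+ 2 * 1.
  exact: (H (dmean b)).2.
by move=> c; apply: (hasI_eq (H c)) => //; ring.
Qed.

Lemma admissible_hasI b f : admissible b f ->
  [/\ hasI b 1, hasI (fun x => x * b x) (dmean b),
      forall c, hasI (fun x => (x - c) ^+ 2 * b x) (dvar b + (dmean b - c) ^+ 2)
    & hasI (KLint b f) (KL b f)].
Proof.
move=> [[mb [b0 [Ib b1]]] [IK [Ix Ixx]]].
have hb : hasI b 1 by [].
split => //; exact: dvar_moments.
Qed.

Lemma admissible_intro b f : measurable_fun setT b -> (forall x, 0 <= b x) ->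
  hasI b 1 -> integrableR (fun x => x * b x) ->
  integrableR (fun x => x ^+ 2 * b x) -> integrableR (KLint b f) ->
  admissible b f.
Proof. by move=> mb b0 [b1 b1'] bx bxx bK. Qed.

End Admissible.

(** * Divergence from the tilted densities *)

Section Gap.
Context {R : realType}.
Variables (f : R -> R) (r tau : R).
Hypotheses (f_norm : forall r tau : R, 0 < tau -> integrableR (qdens f r tau))
  (tau0 : 0 < tau).
Implicit Types (b phi g : R -> R).

Local Notation p := (pdens f r tau).
Local Notation Z := (RI (qdens f r tau)).

(* The divergence [KL(b || p)], rewritten through the moments of [b]. *)
Definition gap b : R :=
  KL b f + (dvar b + (dmean b - r) ^+ 2) / (2 * tau) + ln Z.

Lemma hasI_gap b : admissible b f ->
  hasI (fun x => b x * (ln (b x) - ln (p x))) (gap b).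
Proof.
move=> /admissible_hasI[b1 _ bv bK].
apply: (hasI_eq (hasID (hasID bK (hasIZ (2 * tau)^-1 (bv r))) (hasIZ (ln Z) b1))).
  by move=> x; rewrite (ln_pdens r f_norm tau0) /KLint; ring.
by rewrite /gap; ring.
Qed.

Lemma admissible_pdens : admissible p f.
Proof.
have [i1 i2] := hasI_centered_pdens r f_norm tau0.
have i0 := hasI_pdens r f_norm tau0.
apply: admissible_intro => //.
- exact: measurable_pdens.
- by move=> x; exact/ltW/pdens_gt0.
- by apply: (hasI_integrable (hasID i1 (hasIZ r i0))) => x; ring.
- apply: (hasI_integrable (hasID (hasID i2 (hasIZ (2 * r) i1)) (hasIZ (r ^+ 2) i0))).
  by move=> x; ring.
- apply: (hasI_integrable (hasID (hasIZ (- (2 * tau)^-1) i2) (hasIZ (- ln Z) i0))).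
  by move=> x; rewrite /KLint (ln_pdens r f_norm tau0); ring.
Qed.

Lemma gap_pdens : gap p = 0.
Proof.
apply: (hasI_unique (hasI_gap admissible_pdens)).
apply: (hasI_eq (hasIZ 0 (hasI_pdens r f_norm tau0))) => [x|]; ring.
Qed.

Lemma gap_ge0 b : admissible b f -> 0 <= gap b.
Proof.
move=> bf; have [b1 _ _ _] := admissible_hasI bf.
have := hasIB b1 (hasI_pdens r f_norm tau0); rewrite subrr => H.
apply: (hasI_le H (hasI_gap bf)) => x.
apply: entropy_pointwise; last exact: pdens_gt0.
by case: bf => -[_ []].
Qed.

(** Both densities have mass one, so the gap is also the integral of the nonnegative defect in
    [entropy_pointwise], which must then vanish almost everywhere. *)
Lemma gap_eq0 b : admissible b f -> gap b = 0 ->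
  {ae @leb R, forall x, b x = p x}.
Proof.
move=> bf g0; have [b1 _ _ _] := admissible_hasI bf.
have b0 x : 0 <= b x by case: bf => -[_ []].
have pgt0 x : 0 < p x by exact: pdens_gt0.
have := hasIB (hasI_gap bf) (hasIB b1 (hasI_pdens r f_norm tau0)).
rewrite g0 subrr subr0 => /hasI_ae0 H.
apply: ae_imp (H _) => [x E|x].
  by apply: entropy_pointwise_eq => //; apply/eqP; rewrite -subr_eq0 E.
by rewrite subr_ge0 entropy_pointwise.
Qed.

(* Testing [b] against the tilted density [p * expR (lam * phi)], whose mass is
   [1 + lam * v + O(lam^2)]. *)
Lemma gap_tilt phi e C b u v lam : measurable_fun setT phi ->
  (forall x, phi x ^+ 2 * expR (e * `|phi x|) <=
             C * expR ((x - r) ^+ 2 / (4 * tau))) ->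
  admissible b f -> hasI (fun x => phi x * b x) u ->
  hasI (fun x => phi x * p x) v -> `|lam| <= e ->
  lam * (u - v) -
    lam ^+ 2 * RI (fun x => phi x ^+ 2 * expR (e * `|phi x|) * p x) <= gap b.
Proof.
move=> mphi phiC bf bu pv lame; have [b1 _ _ _] := admissible_hasI bf.
have b0 x : 0 <= b x by case: bf => -[_ []].
have pgt0 x : 0 < p x by exact: pdens_gt0.
have p1 := hasI_pdens r f_norm tau0.
have I2 : integrableR (fun x => phi x ^+ 2 * expR (e * `|phi x|) * p x).
  apply: (integrableR_pdens_growth f_norm tau0 (C := C)); first by measurability.
  by move=> x; rewrite ger0_norm ?phiC// mulr_ge0 ?sqr_ge0 ?expR_ge0.
have := hasIB (hasID (hasIZ lam bu) b1)
  (hasID (hasID p1 (hasIZ lam pv)) (hasIZ (lam ^+ 2) (hasI_RI I2))).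
set T := RI _ => H.
have -> : lam * (u - v) - lam ^+ 2 * T =
  lam * u + 1 - (1 + lam * v + lam ^+ 2 * T) by ring.
apply: (hasI_le H (hasI_gap bf)) => x.
have := entropy_pointwise (w := p x * expR (lam * phi x)) (b0 x).
rewrite mulr_gt0 ?expR_gt0// => /(_ isT).
rewrite lnM ?posrE ?expR_gt0// expRK => Hb.
(* The condition [|lam| <= e] bounds the remainder by a function free of [lam], so that a single
   integral serves for all small [lam]. *)
have : p x * expR (lam * phi x) <=
    p x * (1 + lam * phi x + lam ^+ 2 * (phi x ^+ 2 * expR (e * `|phi x|))).
  rewrite ler_pM2l//; apply: (le_trans (expR_le_quadratic _)).
  rewrite lerD2l exprMn -mulrA.
  rewrite ler_wpM2l ?sqr_ge0// ler_wpM2l ?sqr_ge0// ler_expR normrM.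
  by rewrite ler_wpM2r.
move: Hb; set E1 := expR (lam * _); set E2 := expR _; set l1 := ln _.
by set l2 := ln _ => ? ?; lra.
Qed.

(** The quantifier order matters: [e] and [C] precede [b], so the bound passes to infima over
    [b]. *)
Lemma gap_tilt_mean : exists e C : R, 0 < e /\ forall b lam,
  admissible b f -> `|lam| <= e ->
  lam * (dmean b - dmean p) - lam ^+ 2 * C <= gap b.
Proof.
have [_ _ pv _] := admissible_hasI admissible_pdens.
have [b1 pm _ _] := admissible_hasI admissible_pdens.
exists 1; eexists; split => // b lam bf lam1.
have [bb bm _ _] := admissible_hasI bf.
have -> : dmean b - dmean p = (dmean b - r * 1) - (dmean p - r * 1) by ring.
apply: (gap_tilt (phi := fun x => x - r) _ (growth_linear_tilt r tau0) bf _ _ lam1).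
- by measurability.
- by apply: (hasI_eq (hasIB bm (hasIZ r bb))) => // x; ring.
- by apply: (hasI_eq (hasIB pm (hasIZ r b1))) => // x; ring.
Qed.

Lemma gap_tilt_second : exists e C : R, 0 < e /\ forall b lam,
  admissible b f -> `|lam| <= e ->
  lam * ((dvar b + (dmean b - r) ^+ 2) - (dvar p + (dmean p - r) ^+ 2))
    - lam ^+ 2 * C <= gap b.
Proof.
have [_ _ pv _] := admissible_hasI admissible_pdens.
exists (8 * tau)^-1; eexists; split; first by rewrite invr_gt0 mulr_gt0.
move=> b lam bf lam1; have [_ _ bv _] := admissible_hasI bf.
apply: (gap_tilt (phi := fun x => (x - r) ^+ 2) _
  (growth_quadratic_tilt r tau0) bf _ _ lam1).
- by measurability.
- exact: bv.
- exact: pv.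
Qed.

Lemma ln1D_norm_le1 g x : `|g x| <= 2^-1 -> `|ln (1 + g x)| <= 1.
Proof.
rewrite ler_norml => /andP[g1 g2]; have g0 : 0 < 1 + g x by lra.
have := ln_le_subr1 g0; have := ln_ge_1subV g0.
have : (1 + g x)^-1 <= 2.
  by rewrite -[leRHS]invrK lef_pV2 ?posrE ?invr_gt0//; lra.
by rewrite ler_norml => ? ? ?; apply/andP; split; lra.
Qed.

(** The witness is [p * (1 + g)]. A bound of one half on [g] keeps it positive with a bounded
    logarithmic correction, hence admissible. *)
Lemma gap_perturb g B m1 m2 : measurable_fun setT g ->
  (forall x, `|g x| <= B) -> B <= 2^-1 ->
  hasI (fun x => g x * p x) 0 ->
  hasI (fun x => x * (g x * p x)) m1 ->
  hasI (fun x => x ^+ 2 * (g x * p x)) m2 ->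
  exists b, [/\ admissible b f, dmean b = dmean p + m1,
    dvar b + dmean b ^+ 2 = dvar p + dmean p ^+ 2 + m2 & gap b <= B ^+ 2].
Proof.
move=> mg gB B2 g0 g1 g2.
have [p1 pm pv pK] := admissible_hasI admissible_pdens.
have p2 : hasI (fun x => x ^+ 2 * p x) (dvar p + dmean p ^+ 2).
  by apply: (hasI_eq (pv 0)) => [x|]; rewrite subr0.
have pgt0 x : 0 < p x by exact: pdens_gt0.
have gx x : 2^-1 <= 1 + g x.
  by have := le_trans (gB x) B2; rewrite ler_norml => /andP[? ?]; lra.
have g0' x : 0 < 1 + g x by have := gx x => ?; lra.
pose b x := p x * (1 + g x).
have bgt0 x : 0 < b x by exact: mulr_gt0 (pgt0 x) (g0' x).
have lnb x : ln (b x) = ln (p x) + ln (1 + g x).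
  by apply: lnM; rewrite posrE.
have b1 : hasI b 1.
  by apply: (hasI_eq (hasID p1 g0)) => [x|]; rewrite /b; ring.
have bm : hasI (fun x => x * b x) (dmean p + m1).
  by apply: (hasI_eq (hasID pm g1)) => [x|//]; rewrite /b; ring.
have b2 : hasI (fun x => x ^+ 2 * b x) (dvar p + dmean p ^+ 2 + m2).
  by apply: (hasI_eq (hasID p2 g2)) => [x|//]; rewrite /b; ring.
have mp : measurable_fun setT p by exact: measurable_pdens.
have mb : measurable_fun setT b by measurability.
have B0 : 0 <= B by exact: le_trans (normr_ge0 _) (gB 0).
have IKp : integrableR (fun x => KLint p f x * (1 + g x)).
  have mK := integrableR_measurable pK.1.
  have aK : integrableR (fun x => `|KLint p f x|).
    by have := integrable_norm pK.1.
  have [I2 _] := hasIZ 2 (hasI_RI aK).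
  apply: (integrableR_dom _ I2); first by measurability.
  move=> x; rewrite normrM mulrC ler_wpM2r// gtr0_norm//.
  by have := le_trans (gB x) B2; rewrite ler_norml => /andP[? ?]; lra.
have IL : integrableR (fun x => b x * ln (1 + g x)).
  have [I2 _] := hasIZ 2 p1.
  apply: (integrableR_dom _ I2); first by measurability.
  move=> x; rewrite normrM gtr0_norm//.
  have := ln1D_norm_le1 (le_trans (gB x) B2) => l1.
  have : p x * (1 + g x) * `|ln (1 + g x)| <= p x * (1 + g x) * 1.
    by rewrite ler_wpM2l// ltW// bgt0.
  have := le_trans (gB x) B2; rewrite ler_norml => /andP[? ?].
  by move=> H; apply: (le_trans H); rewrite mulr1 mulrC ler_pM2r//; lra.
have bf : admissible b f.
  apply: admissible_intro => //; [|exact: bm.1|exact: b2.1|].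
    by move=> y; rewrite ltW.
  apply: (hasI_integrable (hasID (hasI_RI IKp) (hasI_RI IL))) => y.
  by rewrite /KLint lnb /b; ring.
have bmean : dmean b = dmean p + m1 by exact: bm.2.
exists b; split => //.
  have [_ _ bv _] := admissible_hasI bf.
  have := hasI_unique (bv 0) (hasI_eq b2 (g := fun x => (x - 0) ^+ 2 * b x) _ erefl).
  by rewrite subr0 => -> // x; rewrite subr0.
have H := hasID g0 (hasIZ (B ^+ 2) p1).
have -> : B ^+ 2 = 0 + B ^+ 2 * 1 by rewrite add0r mulr1.
apply: (hasI_le (hasI_gap bf) H) => x.
rewrite lnb [ln (p x) + _]addrC addrK /b.
have -> : g x * p x + B ^+ 2 * p x = p x * (g x + B ^+ 2) by ring.
(* By [ln (1 + g) <= g] the integrand is at most [p * (g + g^2)]; the linear part integrates to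
   zero, which makes the gap second order. *)
rewrite -mulrA ler_pM2l//; apply: (@le_trans _ _ ((1 + g x) * g x)).
  by rewrite ler_pM2l//; have := ln_le_subr1 (g0' x) => ?; lra.
have : g x ^+ 2 <= B ^+ 2 by rewrite -[g x ^+ 2]real_normK ?num_real// ler_sqr ?nnegrE.
lra.
Qed.

End Gap.

(** * Small changes of the moments *)

Lemma near0_norm_le {R : realType} (e : R) : 0 < e ->
  \forall h \near (0 : R), `|h| <= e.
Proof. by move=> e0; exists e => // h /=; rewrite sub0r normrN => /ltW. Qed.

Section LocalPerturbation.
Context {R : realType}.
Variables (f : R -> R) (r tau : R).
Hypotheses (f_norm : forall r tau : R, 0 < tau -> integrableR (qdens f r tau))
  (tau0 : 0 < tau).

Local Notation p := (pdens f r tau).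
Local Notation chi := (\1_(`[-1, 1]%classic : set R)).
Local Notation mom k := (RI (fun x : R => x ^+ k * (chi x * p x))).

Lemma measurable_chi : measurable_fun setT (chi : R -> R).
Proof. by apply: measurable_indic; exact: measurable_itv. Qed.

Lemma chi_in x : -1 <= x <= 1 -> chi x = 1 :> R.
Proof. by move=> x1; rewrite indicE mem_set//= in_itv. Qed.

Lemma chi_ge0 x : 0 <= chi x :> R.
Proof. by rewrite indicE. Qed.

(** The reason for cutting off at [[-1, 1]]: a truncated quadratic is bounded by the sum of the
    absolute values of its coefficients. *)
Lemma chi_exprn_le1 k x : `|x ^+ k * chi x| <= 1 :> R.
Proof.
have [x1|x1] := boolP (-1 <= x <= 1).
  by rewrite chi_in// mulr1 normrX exprn_ile1// ler_norml.
rewrite indicE memNset ?mulr0 ?normr0//.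
by rewrite /= in_itv; exact/negP.
Qed.

Lemma hasI_mom k : hasI (fun x => x ^+ k * (chi x * p x)) (mom k).
Proof.
apply: hasI_RI.
have mp : measurable_fun setT p by exact: measurable_pdens.
have mchi := measurable_chi.
have [I1 _] := hasI_pdens r f_norm tau0.
apply: (integrableR_dom _ I1); first by measurability.
move=> x; have p0 := pdens_gt0 r f_norm tau0 x.
by rewrite mulrA normrM (gtr0_norm p0) ger_pMl// chi_exprn_le1.
Qed.

Lemma hasI_quadratic al be ga k :
  hasI (fun x => x ^+ k * ((al + be * x + ga * x ^+ 2) * chi x * p x))
       (al * mom k + be * mom k.+1 + ga * mom k.+2).
Proof.
apply: (hasI_eq (hasID (hasID (hasIZ al (hasI_mom k)) (hasIZ be (hasI_mom k.+1)))
  (hasIZ ga (hasI_mom k.+2)))) => // x.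
by rewrite !exprS; ring.
Qed.

(* Positive definiteness of the Gram matrix of [1, x, x^2]. *)
Lemma mom_gram_gt0 al be ga : (al, be, ga) != (0, 0, 0) ->
  0 < al * (al * mom 0 + be * mom 1 + ga * mom 2)
    + be * (al * mom 1 + be * mom 2 + ga * mom 3)
    + ga * (al * mom 2 + be * mom 3 + ga * mom 4).
Proof.
move=> nz; set u := (X in 0 < X).
pose P x := (al + be * x + ga * x ^+ 2) ^+ 2 * (chi x * p x).
have Pu : hasI P u.
  apply: (hasI_eq (hasID (hasID (hasIZ al (hasI_quadratic al be ga 0))
    (hasIZ be (hasI_quadratic al be ga 1))) (hasIZ ga (hasI_quadratic al be ga 2)))) => //.
  by move=> x; rewrite /P; ring.
have P0 x : 0 <= P x.
  by rewrite mulr_ge0 ?sqr_ge0// mulr_ge0 ?chi_ge0// ltW// pdens_gt0.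
have u0 : 0 <= u by exact: hasI_ge0 P0 Pu.
rewrite lt_neqAle u0 andbT; apply: contra_neq nz => u00.
rewrite -u00 in Pu.
(* A vanishing quadratic form makes the polynomial zero almost everywhere on [[-1, 1]], so it has a
   root in every subinterval; roots in three disjoint ones kill all coefficients, by divided
   differences. *)
have root a b : -1 <= a -> a < b -> b <= 1 ->
    exists2 x, a < x < b & al + be * x + ga * x ^+ 2 = 0.
  move=> a1 ab b1; have [x abx Px] := ae_exists_itv ab (hasI_ae0 P0 Pu).
  exists x => //; apply/eqP; rewrite -sqrf_eq0; apply/eqP.
  move/eqP: Px; rewrite /P chi_in ?mul1r; last by case/andP: abx => *; lra.
  by rewrite mulf_eq0 (gt_eqF (pdens_gt0 r f_norm tau0 x)) orbF => /eqP.
have [x1 /andP[_ h1] e1] : exists2 x, -1 < x < - 2^-1 & al + be * x + ga * x ^+ 2 = 0.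
  by apply: root; lra.
have [x2 /andP[h2 h2'] e2] : exists2 x, - 2^-1 < x < 2^-1 & al + be * x + ga * x ^+ 2 = 0.
  by apply: root; lra.
have [x3 /andP[h3 _] e3] : exists2 x, 2^-1 < x < 1 & al + be * x + ga * x ^+ 2 = 0.
  by apply: root; lra.
have x12 : x1 - x2 != 0 by rewrite lt_eqF//; lra.
have x13 : x1 - x3 != 0 by rewrite lt_eqF//; lra.
have x23 : x2 - x3 != 0 by rewrite lt_eqF//; lra.
have d12 : be + ga * (x1 + x2) = 0.
  by apply: (mulfI x12); rewrite mulr0; lra.
have d13 : be + ga * (x1 + x3) = 0.
  by apply: (mulfI x13); rewrite mulr0; lra.
have ga0 : ga = 0.
  by apply: (mulfI x23); rewrite mulr0; lra.
have be0 : be = 0 by rewrite ga0 in d12; lra.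
have al0 : al = 0 by rewrite ga0 be0 in e1; lra.
by rewrite al0 be0 ga0.
Qed.

(** Gram-Schmidt on [1, x, x^2] with weight [chi * p]: [x - c] and [x^2 - a * x - d] are the
    orthogonalized monomials, [N1] and [N2] their squared norms. The second direction is
    [(x^2 - a * x - d) / N2]; the first is [(x - c) / N1] minus [a] times the second, which cancels
    its second moment. *)
Lemma moment_directions :
  (exists al be ga, [/\ al * mom 0 + be * mom 1 + ga * mom 2 = 0,
    al * mom 1 + be * mom 2 + ga * mom 3 = 1 &
    al * mom 2 + be * mom 3 + ga * mom 4 = 0]) /\
  (exists al be ga, [/\ al * mom 0 + be * mom 1 + ga * mom 2 = 0,
    al * mom 1 + be * mom 2 + ga * mom 3 = 0 &
    al * mom 2 + be * mom 3 + ga * mom 4 = 1]).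
Proof.
have pos := mom_gram_gt0.
move: (mom 0) (mom 1) (mom 2) (mom 3) (mom 4) pos => M0 M1 M2 M3 M4 pos.
have M00 : 0 < M0.
  have := pos 1 0 0; rewrite !xpair_eqE oner_eq0 => /(_ isT); lra.
have M0n := lt0r_neq0 M00.
have [c cM0] : exists c, c * M0 = M1 by exists (M1 / M0); rewrite divfK.
have N10 : 0 < M2 - c * M1.
  have := pos (- c) 1 0; rewrite !xpair_eqE oner_eq0 andbF => /(_ isT).
  by congr (0 < _); rewrite -cM0; ring.
have N1n := lt0r_neq0 N10.
have [a aN1] : exists a, a * (M2 - c * M1) = M3 - c * M2.
  by exists ((M3 - c * M2) / (M2 - c * M1)); rewrite divfK.
have [d dM0] : exists d, d * M0 = M2 - a * M1.
  by exists ((M2 - a * M1) / M0); rewrite divfK.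
have dM1 : d * M1 = c * (M2 - a * M1) by rewrite -dM0 -cM0; ring.
have E0 : - d * M0 + - a * M1 + 1 * M2 = 0 by lra.
have E1 : - d * M1 + - a * M2 + 1 * M3 = 0 by lra.
have N20 : 0 < - d * M2 + - a * M3 + 1 * M4.
  have := pos (- d) (- a) 1; rewrite !xpair_eqE oner_eq0 andbF => /(_ isT).
  by rewrite E0 E1; congr (0 < _); ring.
have F0 : - c * M0 + 1 * M1 + 0 * M2 = 0 by lra.
have F2 : - c * M2 + 1 * M3 + 0 * M4 = a * (M2 - c * M1) by lra.
have [N1 N1E] : exists N1, N1 = M2 - c * M1 by eexists.
have F1 : - c * M1 + 1 * M2 + 0 * M3 = N1 by rewrite N1E; ring.
have [N2 E2] : exists N2, - d * M2 + - a * M3 + 1 * M4 = N2 by eexists.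
rewrite -N1E in N1n F2; have N2n := lt0r_neq0 N20; rewrite E2 in N2n.
split; last first.
  exists (- d / N2), (- a / N2), (1 / N2); split.
  - by rewrite -[RHS](mul0r N2^-1) -E0; ring.
  - by rewrite -[RHS](mul0r N2^-1) -E1; ring.
  - by rewrite -[RHS](mulfV N2n) -{4}E2; ring.
exists (- c / N1 - a * (- d / N2)), (1 / N1 - a * (- a / N2)),
  (0 / N1 - a * (1 / N2)); split.
- transitivity ((- c * M0 + 1 * M1 + 0 * M2) / N1
    - a * (- d * M0 + - a * M1 + 1 * M2) / N2); first by ring.
  by rewrite F0 E0; ring.
- transitivity ((- c * M1 + 1 * M2 + 0 * M3) / N1
    - a * (- d * M1 + - a * M2 + 1 * M3) / N2); first by ring.
  by rewrite F1 E1 mulfV//; ring.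
- transitivity ((- c * M2 + 1 * M3 + 0 * M4) / N1
    - a * (- d * M2 + - a * M3 + 1 * M4) / N2); first by ring.
  by rewrite F2 E2 !mulfK// subrr.
Qed.

Lemma gap_moments a1 a2 : exists C, \forall h \near (0 : R), exists b,
  [/\ admissible b f, dmean b = dmean p + a1 * h,
      dvar b = dvar p + a2 * h & gap f r tau b <= C * h ^+ 2].
Proof.
have [[al1 [be1 [ga1 [u0 u1 u2]]]] [al2 [be2 [ga2 [v0 v1 v2]]]]] := moment_directions.
pose S1 := `|al1| + `|be1| + `|ga1|; pose S2 := `|al2| + `|be2| + `|ga2|.
pose K := `|a2 + 2 * dmean p * a1| + a1 ^+ 2.
pose B := `|a1| * S1 + K * S2.
have K0 : 0 <= K by rewrite addr_ge0 ?sqr_ge0.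
have S10 : 0 <= S1 by rewrite !addr_ge0.
have S20 : 0 <= S2 by rewrite !addr_ge0.
have B0 : 0 <= B by rewrite addr_ge0 ?mulr_ge0.
have B1 : 0 < 2^-1 / (B + 1) by rewrite divr_gt0//; lra.
exists (B ^+ 2); near=> h.
have h1 : `|h| <= 1 by near: h; exact: near0_norm_le.
have hB : `|h| <= 2^-1 / (B + 1) by near: h; exact: near0_norm_le.
(* [d1] and [d2] are the changes of the raw moments. The quadratic term of [d2] compensates for the
   moving mean, so that the variance changes by exactly [a2 * h]; [K] bounds [d2 / h] when
   [|h| <= 1]. *)
pose d1 := a1 * h; pose d2 := (a2 + 2 * dmean p * a1) * h + a1 ^+ 2 * h ^+ 2.
pose al := d1 * al1 + d2 * al2; pose be := d1 * be1 + d2 * be2.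
pose ga := d1 * ga1 + d2 * ga2.
have d1h : `|d1| <= `|a1| * `|h| by rewrite normrM.
have d2h : `|d2| <= K * `|h|.
  rewrite [K * _]mulrDl; apply: (le_trans (ler_normD _ _)); apply: lerD.
    by rewrite normrM.
  rewrite normrM !normrX !real_normK ?num_real// ler_wpM2l ?sqr_ge0//.
  by rewrite -[h ^+ 2]real_normK ?num_real//; have := normr_ge0 h => ?; nra.
have coef x y : `|d1 * x + d2 * y| <= (`|a1| * `|x| + K * `|y|) * `|h|.
  apply: (le_trans (ler_normD _ _)); rewrite !normrM.
  have := ler_wpM2r (normr_ge0 x) d1h; have := ler_wpM2r (normr_ge0 y) d2h.
  by move=> ? ?; lra.
have sumB : `|al| + `|be| + `|ga| <= B * `|h|.
  have := coef al1 al2; have := coef be1 be2; have := coef ga1 ga2.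
  by rewrite -/al -/be -/ga /B /S1 /S2 => ? ? ?; lra.
pose g x := (al + be * x + ga * x ^+ 2) * chi x.
have gB x : `|g x| <= B * `|h|.
  apply: (le_trans _ sumB).
  have -> : g x = al * (x ^+ 0 * chi x) + be * (x ^+ 1 * chi x) + ga * (x ^+ 2 * chi x).
    by rewrite /g; ring.
  apply: (le_trans (ler_normD _ _)); apply: lerD.
    apply: (le_trans (ler_normD _ _)).
    by apply: lerD; rewrite normrM ler_piMr// chi_exprn_le1.
  by rewrite normrM ler_piMr// chi_exprn_le1.
have B2 : B * `|h| <= 2^-1.
  move: hB; rewrite ler_pdivlMr; last lra.
  by have := normr_ge0 h => ? ?; nra.
have mg : measurable_fun setT g by have := measurable_chi => ?; measurability.
have G0 : hasI (fun x => g x * p x) 0.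
  apply: (hasI_eq (hasI_quadratic al be ga 0)) => [x|]; first by rewrite mul1r.
  transitivity (d1 * (al1 * mom 0 + be1 * mom 1 + ga1 * mom 2)
      + d2 * (al2 * mom 0 + be2 * mom 1 + ga2 * mom 2)).
    by rewrite /al /be /ga; ring.
  by rewrite u0 v0; ring.
have G1 : hasI (fun x => x * (g x * p x)) d1.
  apply: (hasI_eq (hasI_quadratic al be ga 1)) => //.
  transitivity (d1 * (al1 * mom 1 + be1 * mom 2 + ga1 * mom 3)
      + d2 * (al2 * mom 1 + be2 * mom 2 + ga2 * mom 3)).
    by rewrite /al /be /ga; ring.
  by rewrite u1 v1; ring.
have G2 : hasI (fun x => x ^+ 2 * (g x * p x)) d2.
  apply: (hasI_eq (hasI_quadratic al be ga 2)) => //.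
  transitivity (d1 * (al1 * mom 2 + be1 * mom 3 + ga1 * mom 4)
      + d2 * (al2 * mom 2 + be2 * mom 3 + ga2 * mom 4)).
    by rewrite /al /be /ga; ring.
  by rewrite u2 v2; ring.
have [b [bf bm bv bg]] := gap_perturb f_norm tau0 mg gB B2 G0 G1 G2.
exists b; split => //; last first.
  by apply: (le_trans bg); rewrite exprMn real_normK ?num_real.
have -> : dvar b = dvar p + dmean p ^+ 2 + d2 - dmean b ^+ 2 by rewrite -bv; ring.
by rewrite bm /d1 /d2; ring.
Unshelve. all: by end_near.
Qed.

End LocalPerturbation.

(** * Existence of admissible densities with given mean and variance *)

Section Feasibility.
Context {R : realType}.
Variable (f : R -> R).
Hypothesis f_meas : measurable_fun setT f.
Variable c : R.
Implicit Types b phi : R -> R.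

(* The factor [expR (- `|f x|)] bounds [f] times the density, so that the
   divergence integrand is bounded with compact support. *)
Definition tame b := exists phi M K, [/\ measurable_fun setT phi,
  forall x, 0 <= phi x <= M, forall x, phi x != 0 -> `|x - c| <= K,
  b = (fun x => phi x * expR (- `|f x|)) & hasI b 1].

Lemma integrableR_bounded_support (g : R -> R) (M K : R) : measurable_fun setT g ->
  (forall x, `|g x| <= M) -> (forall x, g x != 0 -> `|x - c| <= K) ->
  integrableR g.
Proof.
move=> mg gM gK; pose A := `[c - K, c + K]%classic : set R.
have IA : integrableR (\1_A : R -> R).
  exact: (integrable_indic_itv (c - K) (c + K) true false).
have [I1 _] := hasIZ M (hasI_RI IA).
apply: (integrableR_dom mg I1) => x; rewrite indicE.
have [gx0|gx0] := eqVneq (g x) 0.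
  by rewrite gx0 normr0 mulr_ge0// (le_trans _ (gM x)).
rewrite mem_set; first by rewrite mulr1.
rewrite /A /= in_itv /=.
by have := gK x gx0; rewrite ler_norml => /andP[? ?]; apply/andP; split; lra.
Qed.

Lemma norm_expRN_le1 (y : R) : `|y| * expR (- `|y|) <= 1.
Proof.
have := expR_ge1Dx `|y|; have := expRxMexpNx_1 `|y|.
have := expR_gt0 (- `|y|); set s := expR (- _); set t := expR _.
by move: s t => s t s0 ts t1; nra.
Qed.

Lemma xlnx_norm_le (y M : R) : 0 <= y <= M -> `|y * ln y| <= M ^+ 2 + 1.
Proof.
rewrite le_eqVlt => /andP[/predU1P[<-|y0] yM].
  by rewrite mul0r normr0 addr_ge0 ?sqr_ge0.
have := ln_le_subr1 y0; have := ln_ge_1subV y0.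
have yy : y * y^-1 = 1 by rewrite divff// gt_eqF.
move: (ln y) (y^-1) yy => l v yv l1 l2.
have : y - 1 <= y * l.
  have -> : y - 1 = y * (1 - v) by rewrite mulrBr yv mulr1.
  by rewrite ler_pM2l.
have : y * l <= y * (y - 1) by rewrite ler_pM2l.
by move=> ? ?; rewrite ler_norml; apply/andP; split; nra.
Qed.

Lemma tame_admissible b : tame b ->
  [/\ admissible b f, hasI (fun x => (x - c) * b x) (dmean b - c) &
     hasI (fun x => (x - c) ^+ 2 * b x) (dvar b + (dmean b - c) ^+ 2)].
Proof.
move=> [phi [M [K [mphi phiM phiK bE b1]]]].
have e0 x : 0 < expR (- `|f x|) by exact: expR_gt0.
have e1 x : expR (- `|f x|) <= 1 by rewrite -expR0 ler_expR oppr_le0.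
have mb : measurable_fun setT b by rewrite bE; measurability.
have phi0 x : 0 <= phi x by case/andP: (phiM x).
have M0 : 0 <= M by case/andP: (phiM 0); exact: le_trans.
have b0 x : 0 <= b x by rewrite bE mulr_ge0// ltW.
have bM x : b x <= M.
  have /andP[p0 pM] := phiM x.
  by rewrite bE (le_trans _ pM)// ler_piMr.
have bK x : b x != 0 -> `|x - c| <= K.
  by rewrite bE mulf_eq0 negb_or => /andP[/phiK].
have I1 : integrableR (fun x => (x - c) * b x).
  apply: (@integrableR_bounded_support _ (`|K| * M) K); first by measurability.
    move=> x; have [->|/bK xK] := eqVneq (b x) 0.
      by rewrite mulr0 normr0 mulr_ge0.
    by rewrite normrM (ger0_norm (b0 x)) ler_pM// (le_trans xK)// ler_norm.
  by move=> x; rewrite mulf_eq0 negb_or => /andP[_ /bK].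
have I2 : integrableR (fun x => (x - c) ^+ 2 * b x).
  apply: (@integrableR_bounded_support _ (K ^+ 2 * M) K); first by measurability.
    move=> x; have [->|/bK xK] := eqVneq (b x) 0.
      by rewrite mulr0 normr0 mulr_ge0 ?sqr_ge0.
    rewrite normrM (ger0_norm (b0 x)) ler_pM// normrX ler_sqr ?nnegrE//.
    exact: le_trans xK.
  by move=> x; rewrite mulf_eq0 negb_or => /andP[_ /bK].
have IK : integrableR (KLint b f).
  apply: (@integrableR_bounded_support _ (M ^+ 2 + 1 + 2 * M) K).
  - by rewrite /KLint; measurability.
  - move=> x; have [phi00|phi00] := eqVneq (phi x) 0.
      by rewrite /KLint bE phi00 !mul0r normr0 !addr_ge0 ?mulr_ge0 ?sqr_ge0.
    have phix : 0 < phi x by rewrite lt_neqAle eq_sym phi00 phi0.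
    (* Since [ln b = ln phi - |f|], the term [f] enters only as [f - |f|], which the tempering
       factor keeps bounded. *)
    have -> : KLint b f x = phi x * ln (phi x) * expR (- `|f x|) +
        phi x * ((f x - `|f x|) * expR (- `|f x|)).
      by rewrite /KLint bE lnM ?posrE// expRK; ring.
    apply: (le_trans (ler_normD _ _)); apply: lerD.
      rewrite normrM (gtr0_norm (e0 x)) (le_trans _ (xlnx_norm_le (phiM x)))//.
      by rewrite ler_piMr.
    rewrite normrM (gtr0_norm phix) mulrC; apply: ler_pM => //; last first.
      by case/andP: (phiM x).
    rewrite normrM (gtr0_norm (e0 x)).
    apply: (@le_trans _ _ (2 * `|f x| * expR (- `|f x|))).
      rewrite ler_wpM2r ?expR_ge0//; apply: (le_trans (ler_normB _ _)).
      by rewrite normr_id; lra.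
    by have := norm_expRN_le1 (f x) => ?; lra.
  - by move=> x; rewrite mulf_eq0 negb_or => /andP[/bK].
have xb : integrableR (fun x => x * b x).
  by apply: (hasI_integrable (hasID (hasI_RI I1) (hasIZ c b1))) => x; ring.
have xxb : integrableR (fun x => x ^+ 2 * b x).
  apply: (hasI_integrable (hasID (hasID (hasI_RI I2)
    (hasIZ (2 * c) (hasI_RI I1))) (hasIZ (c ^+ 2) b1))) => x; ring.
have bf : admissible b f by exact: admissible_intro.
have [_ bm bv _] := admissible_hasI bf.
split => //.
by apply: (hasI_eq (hasIB bm (hasIZ c b1))) => [x|]; ring.
Qed.

Lemma tame_mix (b1 b2 : R -> R) (t : R) : tame b1 -> tame b2 -> 0 <= t <= 1 ->
  tame (fun x => (1 - t) * b1 x + t * b2 x).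
Proof.
move=> [phi1 [M1 [K1 [m1 p1 k1 -> h1]]]] [phi2 [M2 [K2 [m2 p2 k2 -> h2]]]].
move=> /andP[t0 t1]; have t1' : 0 <= 1 - t by lra.
exists (fun x => (1 - t) * phi1 x + t * phi2 x), (M1 + M2), (Num.max K1 K2); split.
- by measurability.
- move=> x; have /andP[a1 a2] := p1 x; have /andP[a3 a4] := p2 x.
  rewrite addr_ge0 ?mulr_ge0//=; apply: lerD.
    by apply: le_trans a2; rewrite ler_piMl//; lra.
  by apply: le_trans a4; rewrite ler_piMl//; lra.
- move=> x; rewrite le_max.
  have [e1|/k1 ->//] := eqVneq (phi1 x) 0.
  have [e2|/k2 ->//] := eqVneq (phi2 x) 0; last by rewrite orbT.
  by rewrite e1 e2 !mulr0 addr0 eqxx.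
- by apply/funext => x; ring.
- by apply: (hasI_eq (hasID (hasIZ (1 - t) h1) (hasIZ t h2))) => //; ring.
Qed.

(** The integral of [phi] is affine along the mixture, so opposite signs at the ends give an
    explicit zero. *)
Lemma tame_interpolate (phi b1 b2 : R -> R) u v : tame b1 -> tame b2 ->
  hasI (fun x => phi x * b1 x) u -> hasI (fun x => phi x * b2 x) v ->
  u < 0 < v ->
  exists t, [/\ 0 <= t <= 1, tame (fun x => (1 - t) * b1 x + t * b2 x) &
    hasI (fun x => phi x * ((1 - t) * b1 x + t * b2 x)) 0].
Proof.
move=> g1 g2 hu hv /andP[u0 v0]; have uv : 0 < v - u by lra.
have t01 : 0 <= - u / (v - u) <= 1.
  apply/andP; split; first by apply: divr_ge0; lra.
  by rewrite ler_pdivrMr//; lra.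
exists (- u / (v - u)); split => //; first exact: tame_mix.
set t := - u / (v - u).
apply: (hasI_eq (hasID (hasIZ (1 - t) hu) (hasIZ t hv))) => [x|]; first by ring.
by rewrite /t; field; rewrite gt_eqF.
Qed.

Lemma tame_interval (a a' : R) : a < a' -> exists b, tame b /\
  forall x, b x != 0 -> a <= x <= a'.
Proof.
move=> aa'; pose A := `[a, a']%classic : set R.
pose phi := (\1_A : R -> R); pose b x := phi x * expR (- `|f x|).
have mA : measurable A by exact: measurable_itv.
have mphi : measurable_fun setT phi by exact: measurable_indic.
have phi01 x : 0 <= phi x <= 1 by rewrite /phi indicE ler0n lern1; case: (_ \in _).
have phiA x : phi x != 0 -> a <= x <= a'.
  by rewrite /phi indicE pnatr_eq0 eqb0 negbK inE /A /= in_itv.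
have e0 x : 0 < expR (- `|f x|) by exact: expR_gt0.
have bA x : b x != 0 -> a <= x <= a'.
  by rewrite mulf_eq0 negb_or => /andP[/phiA].
have AK x : a <= x <= a' -> `|x - c| <= `|a - c| + `|a' - c|.
  move=> /andP[ax xa]; have := ler_norm (a' - c); have := ler_norm (- (a - c)).
  rewrite normrN => ? ?; have := normr_ge0 (a - c); have := normr_ge0 (a' - c).
  by move=> ? ?; rewrite ler_norml; apply/andP; split; lra.
have Ib : integrableR b.
  apply: (@integrableR_bounded_support _ 1 (`|a - c| + `|a' - c|)).
  - by rewrite /b; measurability.
  - move=> x; have /andP[p0 p1] := phi01 x.
    rewrite normrM (ger0_norm p0) (gtr0_norm (e0 x)).
    have e1 : expR (- `|f x|) <= 1 by rewrite -expR0 ler_expR oppr_le0.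
    by rewrite mulr_ile1 ?expR_ge0.
  - by move=> x /bA /AK.
have N0 : 0 < RI b.
  apply: (hasI_gt0 (f := b)); last exact: hasI_RI.
    by move=> x; have /andP[p0 p1] := phi01 x; rewrite mulr_ge0// ltW.
  exists a, a'; split => // x /andP[ax xa].
  rewrite /b /phi indicE mem_set ?mul1r//= /A /= in_itv /=.
  by rewrite !ltW.
exists (fun x => (RI b)^-1 * phi x * expR (- `|f x|)); split; last first.
  by move=> x; rewrite -mulrA mulf_eq0 negb_or => /andP[_ /bA].
exists (fun x => (RI b)^-1 * phi x), (RI b)^-1, (`|a - c| + `|a' - c|); split => //.
- by measurability.
- move=> x; have /andP[p0 p1] := phi01 x.
  have Ni : 0 <= (RI b)^-1 by rewrite invr_ge0 ltW.
  by rewrite mulr_ge0//= ler_piMr.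
- by move=> x; rewrite mulf_eq0 negb_or => /andP[_ /phiA /AK].
- apply: (hasI_eq (hasIZ (RI b)^-1 (hasI_RI Ib))) => [x|]; first by rewrite mulrA.
  by rewrite mulVf// gt_eqF.
Qed.

Lemma hasI_tame_le (phi b : R -> R) u k : tame b -> hasI (fun x => phi x * b x) u ->
  (forall x, b x != 0 -> phi x <= k) -> u <= k.
Proof.
move=> [psi [M [K [_ pM _ bE b1]]]] hu bk; rewrite -[k]mulr1.
apply: (hasI_le hu (hasIZ k b1)) => x.
have [->|bx] := eqVneq (b x) 0; first by rewrite !mulr0.
rewrite ler_wpM2r ?bk// bE mulr_ge0 ?expR_ge0//.
by case/andP: (pM x).
Qed.

(** Mix a density on [[c - hi, c - lo]] with one on [[c + lo, c + hi]] to centre the mean. Every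
    point of the support stays at distance between [lo] and [hi] from [c], whatever the mixing
    weight, and this brackets the variance. *)
Lemma tame_centered (lo hi : R) : 0 < lo -> lo < hi -> exists b, [/\ tame b,
  dmean b = c, lo ^+ 2 <= dvar b & dvar b <= hi ^+ 2].
Proof.
move=> lo0 lohi.
have [|b1 [g1 s1]] := @tame_interval (c - hi) (c - lo); first lra.
have [|b2 [g2 s2]] := @tame_interval (c + lo) (c + hi); first lra.
have [_ h1 _] := tame_admissible g1; have [_ h2 _] := tame_admissible g2.
have u0 : dmean b1 - c <= - lo.
  by apply: (hasI_tame_le g1 h1) => x /s1 /andP[? ?]; lra.
have v0 : - (dmean b2 - c) <= - lo.
  apply: (hasI_tame_le (phi := fun x => - (x - c)) g2).
    by apply: (hasI_eq (hasIZ (-1) h2)) => [x|]; ring.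
  by move=> x /s2 /andP[? ?]; lra.
have [|t [t01 gt ht]] := tame_interpolate g1 g2 h1 h2.
  by apply/andP; split; lra.
set b := fun x : R => _ in gt ht.
have [_ hm hv] := tame_admissible gt.
have bm := hasI_unique hm ht.
have bE : dmean b = c by lra.
rewrite bE subrr expr0n addr0 in hv.
have supp x : b x != 0 -> lo ^+ 2 <= (x - c) ^+ 2 <= hi ^+ 2.
  have [e1|/s1 /andP[? ?] _] := eqVneq (b1 x) 0; last by apply/andP; split; nra.
  have [e2|/s2 /andP[? ?] _] := eqVneq (b2 x) 0; last by apply/andP; split; nra.
  by rewrite /b e1 e2 !mulr0 addr0 eqxx.
exists b; split => //; last first.
  by apply: (hasI_tame_le gt hv) => x /supp /andP[].
rewrite -lerN2; apply: (hasI_tame_le (phi := fun x => - (x - c) ^+ 2) gt).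
  by apply: (hasI_eq (hasIZ (-1) hv)) => [x|]; ring.
by move=> x /supp /andP[? _]; rewrite lerN2.
Qed.

(** Two densities of mean [c], one of variance below [v] and one above, are mixed; with the mean
    fixed, the variance is affine in the weight. *)
Lemma exists_admissible (v : R) : 0 < v ->
  exists b, [/\ admissible b f, dmean b = c & dvar b = v].
Proof.
move=> v0; pose sg := Num.sqrt v.
have sg0 : 0 < sg by rewrite sqrtr_gt0.
have sgE : sg ^+ 2 = v by rewrite sqr_sqrtr// ltW.
have [||b1 [g1 m1 _ v1]] := @tame_centered (sg / 4) (sg / 2); [lra|lra|].
have [||b2 [g2 m2 v2 _]] := @tame_centered (sg * 2) (sg * 3); [lra|lra|].
have H (b : R -> R) : tame b -> dmean b = c ->
    hasI (fun x => ((x - c) ^+ 2 - v) * b x) (dvar b - v).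
  move=> gb mb; have [bf _ hb] := tame_admissible gb.
  have [b1' _ _ _] := admissible_hasI bf.
  apply: (hasI_eq (hasIB hb (hasIZ v b1'))) => [x|]; first by ring.
  by rewrite mb; ring.
have [|t [t01 gt ht]] := tame_interpolate g1 g2 (H _ g1 m1) (H _ g2 m2).
  by apply/andP; split; nra.
set b := fun x : R => _ in gt ht.
have [_ h1 _] := tame_admissible g1; have [_ h2 _] := tame_admissible g2.
have [bf hm hv] := tame_admissible gt.
have bm : dmean b = c.
  suff : dmean b - c = 0 by lra.
  apply: (hasI_unique hm).
  apply: (hasI_eq (hasID (hasIZ (1 - t) h1) (hasIZ t h2))) => [x|].
    by rewrite /b; ring.
  by rewrite m1 m2; ring.
exists b; split => //.
have := hasI_unique (H _ gt bm) ht; lra.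
Qed.

End Feasibility.

(** * Derivatives by squeezing *)

Section Touch.
Context {R : realType}.
Implicit Types (f g L U : R -> R) (a c : R).

Lemma is_derive_squeeze L U g a : L 0 = g 0 -> U 0 = g 0 ->
  is_derive (0 : R) 1 L a -> is_derive (0 : R) 1 U a ->
  (\forall h \near (0 : R), L h <= g h <= U h) -> is_derive (0 : R) 1 g a.
Proof.
move=> L0 U0 dL dU LgU.
have cvgD f : is_derive (0 : R) 1 f a ->
    h^-1 *: ((f \o shift 0) (h *: 1) - f 0) @[h --> 0^'] --> a.
  by move=> df; have := @ex_derive _ _ _ _ _ _ _ df;
    rewrite -[X in _ --> X](@derive_val _ _ _ _ _ _ _ df).
have cvgg : h^-1 *: ((g \o shift 0) (h *: 1) - g 0) @[h --> 0^'] --> a.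
  apply/cvgrPdist_le => e e0.
  have /cvgrPdist_le/(_ _ e0) HL := cvgD _ dL.
  have /cvgrPdist_le/(_ _ e0) HU := cvgD _ dU.
  have H : \forall h \near (0 : R)^', L h <= g h <= U h by exact: nbhs_dnbhs.
  near=> h.
  have hL : `|a - h^-1 *: ((L \o shift 0) (h *: 1) - L 0)| <= e by near: h.
  have hU : `|a - h^-1 *: ((U \o shift 0) (h *: 1) - U 0)| <= e by near: h.
  have /andP[Lg gU] : L h <= g h <= U h by near: h.
  move: hL hU; rewrite /= !addr0 L0 U0 /GRing.scale /= !mulr1 !ler_norml.
  move=> /andP[L1 L2] /andP[U1 U2].
  have [h0|h0] := leP 0 h^-1.
    have := ler_wpM2l h0 Lg; have := ler_wpM2l h0 gU => ? ?.
    by apply/andP; split; lra.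
  have := ler_wnM2l (ltW h0) Lg; have := ler_wnM2l (ltW h0) gU => ? ?.
  by apply/andP; split; lra.
apply: DeriveDef; first by apply/cvg_ex; exists a.
exact: cvg_lim cvgg.
Unshelve. all: by end_near.
Qed.

Lemma is_derive0_eq f g a c : is_derive (0 : R) 1 f a -> f =1 g -> a = c ->
  is_derive (0 : R) 1 g c.
Proof. by move=> df /funext <- <-. Qed.

Lemma is_derive0_cst c : is_derive (0 : R) 1 (fun=> c) 0.
Proof. exact: is_derive_cst. Qed.

Lemma is_derive0_id : is_derive (0 : R) 1 (fun h : R => h) 1.
Proof. exact: is_derive_id. Qed.

Lemma is_derive0D f g a c : is_derive (0 : R) 1 f a -> is_derive (0 : R) 1 g c ->
  is_derive (0 : R) 1 (fun h => f h + g h) (a + c).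
Proof. exact: is_deriveD. Qed.

Lemma is_derive0M f g a c : is_derive (0 : R) 1 f a -> is_derive (0 : R) 1 g c ->
  is_derive (0 : R) 1 (fun h => f h * g h) (f 0 * c + g 0 * a).
Proof. exact: is_deriveM. Qed.

Lemma is_derive0V f a : f 0 != 0 -> is_derive (0 : R) 1 f a ->
  is_derive (0 : R) 1 (fun h => (f h)^-1) (- (f 0) ^- 2 * a).
Proof. exact: is_deriveV. Qed.

Lemma is_derive0_ln f a : 0 < f 0 -> is_derive (0 : R) 1 f a ->
  is_derive (0 : R) 1 (fun h => ln (f h)) ((f 0)^-1 * a).
Proof. by move=> f0 df; apply: is_derive1_comp => //; exact: is_derive1_ln. Qed.

Lemma is_derive0_sum k (f : 'I_k -> R -> R) (a : 'I_k -> R) :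
  (forall j, is_derive (0 : R) 1 (f j) (a j)) ->
  is_derive (0 : R) 1 (fun h => \sum_j f j h) (\sum_j a j).
Proof.
move=> df; apply: (is_derive0_eq (is_derive_sum df)) => // h.
by rewrite fct_sumE.
Qed.

Lemma is_derive0_quadratic (k0 k1 k2 : R) :
  is_derive (0 : R) 1 (fun h : R => k0 + k1 * h + k2 * h ^+ 2) k1.
Proof.
have dlin := is_derive0M (is_derive0_cst k1) is_derive0_id.
have dsq := is_derive0M (is_derive0_cst k2) (is_derive0M is_derive0_id is_derive0_id).
apply: (is_derive0_eq (is_derive0D (is_derive0D (is_derive0_cst k0) dlin) dsq)) => [h|];
  by ring.
Qed.

(* [G] may take infinite values away from [0]; [c] and [a] are its value and
   slope at [0]. *)
Definition touch (G : R -> \bar R) c a := exists L U,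
  [/\ L 0 = c /\ U 0 = c, is_derive (0 : R) 1 L a, is_derive (0 : R) 1 U a &
    \forall h \near (0 : R), ((L h)%:E <= G h <= (U h)%:E)%E].

Lemma touch_value G c a : touch G c a -> G 0 = c%:E.
Proof.
move=> [L [U [[L0 U0] _ _ LGU]]]; have := nbhs_singleton LGU.
by rewrite L0 U0 => cGc; apply/le_anti; rewrite andbC.
Qed.

Lemma touch_eq G1 G2 c1 c2 a1 a2 : touch G1 c1 a1 -> G1 =1 G2 -> c1 = c2 ->
  a1 = a2 -> touch G2 c2 a2.
Proof. by move=> t12 /funext <- <- <-. Qed.

Lemma touch_derive G c a : touch G c a ->
  derivable (fun h => fine (G h)) 0 1 /\ derive1 (fun h => fine (G h)) 0 = a.
Proof.
move=> [L [U [[L0 U0] dL dU LGU]]].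
have LU h : ((L h)%:E <= G h <= (U h)%:E)%E -> L h <= fine (G h) <= U h.
  move=> /andP[]; case: (G h) => [x||]; rewrite ?leye_eq ?leeNy_eq//.
  by rewrite !lee_fin /= => -> ->.
have G0 : fine (G 0) = c.
  by rewrite (touch_value (c := c) (a := a))//; exists L, U.
suff dG : is_derive (0 : R) 1 (fun h => fine (G h)) a.
  split; first exact: (@ex_derive _ _ _ _ _ _ _ dG).
  by rewrite derive1E (@derive_val _ _ _ _ _ _ _ dG).
apply: (is_derive_squeeze (L := L) (U := U)); rewrite ?G0//.
by apply: filterS LGU => h /LU.
Qed.

Lemma touchD G1 G2 c1 c2 a1 a2 : touch G1 c1 a1 -> touch G2 c2 a2 ->
  touch (fun h => G1 h + G2 h)%E (c1 + c2) (a1 + a2).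
Proof.
move=> [L1 [U1 [[l1 u1] dL1 dU1 H1]]] [L2 [U2 [[l2 u2] dL2 dU2 H2]]].
exists (fun h => L1 h + L2 h), (fun h => U1 h + U2 h); split.
- by rewrite l1 u1 l2 u2.
- exact: is_derive0D.
- exact: is_derive0D.
- apply: filterS2 H1 H2 => h /andP[? ?] /andP[? ?].
  by rewrite !EFinD !leeD.
Qed.

Lemma touch_fin f a : is_derive (0 : R) 1 f a -> touch (fun h => (f h)%:E) (f 0) a.
Proof. by move=> df; exists f, f; split => //; near=> h; rewrite !lexx.
Unshelve. all: by end_near. Qed.

(** Feasibility and cost separate over coordinates, so scalar bounds add up. Each coordinate needs a
    minorant of all feasible costs and one feasible point below a majorant, but no minimizer. *)
Lemma touch_inf k (B : Type) (feas : 'I_k -> R -> B -> Prop)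
    (val : 'I_k -> R -> B -> R) (c a : 'I_k -> R) :
  (forall j, exists L U, [/\ L 0 = c j /\ U 0 = c j,
     is_derive (0 : R) 1 L (a j), is_derive (0 : R) 1 U (a j) &
     \forall h \near (0 : R), (forall b, feas j h b -> L h <= val j h b) /\
       exists2 b, feas j h b & val j h b <= U h]) ->
  touch (fun h => ereal_inf [set (\sum_j val j h (b j))%:E |
                  b in [set b : 'I_k -> B | forall j, feas j h (b j)]])
        (\sum_j c j) (\sum_j a j).
Proof.
move=> /choice[L /choice[U H]].
exists (fun h => \sum_j L j h), (fun h => \sum_j U j h); split.
- by split; apply: eq_bigr => j _; case: (H j) => -[].
- by apply: is_derive0_sum => j; case: (H j).
- by apply: is_derive0_sum => j; case: (H j).
pose P j h := (forall b, feas j h b -> L j h <= val j h b) /\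
  exists2 b, feas j h b & val j h b <= U j h.
have : \forall h \near (0 : R), forall j, P j h.
  by apply: (@filter_forall _ _ P (nbhs (0 : R))) => j; case: (H j).
apply: filterS => h Hh; apply/andP; split.
  apply: le_ereal_inf_tmp => _ [b fb <-]; rewrite lee_fin.
  by apply: ler_sum => j _; apply: (Hh j).1.
have /choice[b fb] : forall j, exists b, feas j h b /\ val j h b <= U j h.
  by move=> j; have [_ [b ? ?]] := Hh j; exists b.
apply: (@le_trans _ _ (\sum_j val j h (b j))%:E).
  by apply: ereal_inf_lbound; exists b => // j; case: (fb j).
by rewrite lee_fin; apply: ler_sum => j _; case: (fb j).
Qed.

End Touch.

(** * Slopes of the one-coordinate energies at a Gaussian tilt *)

Section ScalarTouch.
Context {R : realType}.
Variables (f : R -> R) (r tau : R).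
Hypotheses (f_norm : forall r tau : R, 0 < tau -> integrableR (qdens f r tau))
  (tau0 : 0 < tau).
Implicit Types b : R -> R.

Local Notation p := (pdens f r tau).
Local Notation Z := (RI (qdens f r tau)).

(* The contribution of one coordinate to [D(b_z || e^{-f_z}) + H_gauss]. *)
Definition free_energy b (tp : R) :=
  KL b f + (dvar b / (2 * tp) + ln (2 * pi * tp) / 2).

Lemma KL_gap b : KL b f =
  gap f r tau b - (dvar b + (dmean b - r) ^+ 2) / (2 * tau) - ln Z.
Proof. by rewrite /gap; ring. Qed.

(** With prescribed moments, [KL b f] is a fixed quadratic in [h] plus the gap. The gap lies above
    zero for every competitor and below [C * h^2] for the one from [gap_moments]. *)
Lemma KL_touch a1 a2 : exists L U : R -> R,
  [/\ L 0 = KL p f /\ U 0 = KL p f,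
      is_derive (0 : R) 1 L ((r - dmean p) / tau * a1 - a2 / (2 * tau)),
      is_derive (0 : R) 1 U ((r - dmean p) / tau * a1 - a2 / (2 * tau)) &
  \forall h \near (0 : R),
    (forall b, admissible b f /\ dmean b = dmean p + a1 * h /\
       dvar b = dvar p + a2 * h -> L h <= KL b f) /\
    exists2 b, admissible b f /\ dmean b = dmean p + a1 * h /\
       dvar b = dvar p + a2 * h & KL b f <= U h].
Proof.
have [C HC] := gap_moments r f_norm tau0 a1 a2.
have taun := lt0r_neq0 tau0.
pose k0 := KL p f; pose k1 := (r - dmean p) / tau * a1 - a2 / (2 * tau).
pose k2 := - (a1 ^+ 2 / (2 * tau)).
have KLE b h : dmean b = dmean p + a1 * h -> dvar b = dvar p + a2 * h ->
    KL b f = k0 + k1 * h + k2 * h ^+ 2 + gap f r tau b.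
  move=> bm bv; rewrite /k0 !KL_gap bm bv gap_pdens// /k1 /k2.
  by field.
exists (fun h => k0 + k1 * h + k2 * h ^+ 2),
  (fun h => k0 + k1 * h + (k2 + C) * h ^+ 2); split.
- by rewrite !expr0n /= !mulr0 !addr0.
- exact: is_derive0_quadratic.
- exact: is_derive0_quadratic.
apply: filterS HC => h [b [bf bm bv bg]]; split.
  by move=> b' [b'f [b'm b'v]]; rewrite (KLE _ _ b'm b'v) lerDl gap_ge0.
by exists b => //; rewrite (KLE _ _ bm bv); lra.
Qed.

Lemma free_energy_touch_mean a : exists L U : R -> R,
  [/\ L 0 = free_energy p tau /\ U 0 = free_energy p tau,
      is_derive (0 : R) 1 L ((r - dmean p) / tau * a),
      is_derive (0 : R) 1 U ((r - dmean p) / tau * a) &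
  \forall h \near (0 : R),
    (forall b, admissible b f /\ dmean b = dmean p + a * h ->
       L h <= free_energy b tau) /\
    exists2 b, admissible b f /\ dmean b = dmean p + a * h &
      free_energy b tau <= U h].
Proof.
(* The variance is free here: its term in [H_gauss] cancels the one in [KL_gap]. Keeping it constant
   is merely a convenient choice of competitor. *)
have [C HC] := gap_moments r f_norm tau0 a 0.
have taun := lt0r_neq0 tau0.
pose k0 := free_energy p tau; pose k1 := (r - dmean p) / tau * a.
pose k2 := - (a ^+ 2 / (2 * tau)).
have FE b h : dmean b = dmean p + a * h ->
    free_energy b tau = k0 + k1 * h + k2 * h ^+ 2 + gap f r tau b.
  move=> bm; rewrite /k0 /free_energy !KL_gap bm gap_pdens// /k1 /k2.
  by field.
exists (fun h => k0 + k1 * h + k2 * h ^+ 2),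
  (fun h => k0 + k1 * h + (k2 + C) * h ^+ 2); split.
- by rewrite !expr0n /= !mulr0 !addr0.
- exact: is_derive0_quadratic.
- exact: is_derive0_quadratic.
apply: filterS HC => h [b [bf bm bv bg]]; split.
  by move=> b' [b'f b'm]; rewrite (FE _ _ b'm) lerDl gap_ge0.
by exists b => //; rewrite (FE _ _ bm); lra.
Qed.

(** The constraint does not involve [tau], so [p] stays feasible and gives the majorant. For a
    competitor [b] the excess over it is the gap plus [(kap h - kap 0) * (dvar b - dvar p)]; the
    tilted bound with [lam = kap 0 - kap h] cancels the product and leaves [- C * lam^2]. *)
Lemma free_energy_touch_tau a : exists L U : R -> R,
  [/\ L 0 = free_energy p tau /\ U 0 = free_energy p tau,
      is_derive (0 : R) 1 L ((1 / tau - dvar p / tau ^+ 2) / 2 * a),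
      is_derive (0 : R) 1 U ((1 / tau - dvar p / tau ^+ 2) / 2 * a) &
  \forall h \near (0 : R),
    (forall b, admissible b f /\ dmean b = dmean p ->
       L h <= free_energy b (tau + a * h)) /\
    exists2 b, admissible b f /\ dmean b = dmean p &
      free_energy b (tau + a * h) <= U h].
Proof.
have [e [C [e0 HC]]] := gap_tilt_second r f_norm tau0.
have taun := lt0r_neq0 tau0.
pose kap h := (2 * (tau + a * h))^-1.
have kap0 : kap 0 = (2 * tau)^-1 by rewrite /kap mulr0 addr0.
have dlin : is_derive (0 : R) 1 (fun h => tau + a * h) a.
  by apply: (is_derive0_eq (is_derive0D (is_derive0_cst tau) 
    (is_derive0M (is_derive0_cst a) is_derive0_id))) => //; ring.
have dkap : is_derive (0 : R) 1 kap (- a / (2 * tau ^+ 2)).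
  apply: (is_derive0_eq (is_derive0V _ (is_derive0M (is_derive0_cst 2) dlin))) => //=;
    rewrite mulr0 addr0.
    by rewrite mulf_neq0.
  by field.
pose U h := KL p f + (dvar p * kap h + ln (2 * pi * (tau + a * h)) / 2).
pose L h := U h + (- C) * ((kap h - (2 * tau)^-1) * (kap h - (2 * tau)^-1)).
have pi0 : 0 < 2 * pi :> R by rewrite mulr_gt0// pi_gt0.
have dU : is_derive (0 : R) 1 U ((1 / tau - dvar p / tau ^+ 2) / 2 * a).
  have dln : is_derive (0 : R) 1 (fun h => ln (2 * pi * (tau + a * h))) (a / tau).
    apply: (is_derive0_eq (is_derive0_ln _ (is_derive0M (is_derive0_cst (2 * pi)) dlin))) => //=;
      rewrite mulr0 addr0; first exact: mulr_gt0.
    suff aux (P : R) : P != 0 -> (P * tau)^-1 * (P * a + tau * 0) = a / tau.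
      exact/aux/lt0r_neq0.
    by move=> Pn; field; rewrite taun Pn.
  apply: (is_derive0_eq (is_derive0D (is_derive0_cst (KL p f)) (is_derive0D
    (is_derive0M (is_derive0_cst (dvar p)) dkap) (is_derive0M dln (is_derive0_cst 2^-1))))) => //.
  by field.
have dL : is_derive (0 : R) 1 L ((1 / tau - dvar p / tau ^+ 2) / 2 * a).
  have dk := is_derive0D dkap (is_derive0_cst (- (2 * tau)^-1)).
  apply: (is_derive0_eq (is_derive0D dU 
    (is_derive0M (is_derive0_cst (- C)) (is_derive0M dk dk)))) => //=.
  by rewrite kap0 subrr; ring.
have U0 : U 0 = free_energy p tau.
  by rewrite /U /free_energy kap0 mulr0 addr0.
exists L, U; split => //.
  by split => //; rewrite /L kap0 subrr !mulr0 addr0.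
have ckap : \forall h \near (0 : R), `|kap 0 - kap h| <= e.
  have : {for (0 : R), continuous kap}.
    by apply: differentiable_continuous; apply/derivable1_diffP; exact: ex_derive.
  by move=> /cvgrPdist_le/(_ _ e0).
near=> h.
have he : `|kap 0 - kap h| <= e by near: h.
split; last first.
  by exists p; [split => //; exact: admissible_pdens|rewrite /U /free_energy].
move=> b [bf bm]; have := HC b _ bf he; rewrite bm kap0.
rewrite /gap bm /free_energy /L /U -/(kap h).
have := gap_pdens r f_norm tau0; rewrite /gap.
set l := ln Z; set l' := ln (_ * _); set K1 := KL b f; set K2 := KL p f.
rewrite !invfM; move: (kap h) => k g0 g1.
lra.
Unshelve. all: by end_near.
Qed.

End ScalarTouch.

(** * The energies F_SP *)

Section VectorTouch.
Context {R : realType}.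

Lemma infP_le (T : Type) (A : set T) (F : T -> R) (c : R) :
  (forall b, A b -> c <= F b) -> (c%:E <= ereal_inf [set (F b)%:E | b in A])%E.
Proof. by move=> H; apply: le_ereal_inf_tmp => _ [b /H ? <-]; rewrite lee_fin. Qed.

(** A linear function below a parabola through its zero is flat. The test value has the sign of [d]
    and size at most [|d| / (1 + |C|)], where the linear term dominates. *)
Lemma quadratic_tangent_eq0 (d e C : R) : 0 < e ->
  (forall lam, `|lam| <= e -> lam * d <= lam ^+ 2 * C) -> d = 0.
Proof.
move=> e0 H; apply/eqP; apply: contraT => d0.
have K0 : 0 < 1 + `|C| by have := normr_ge0 C => ?; lra.
have dn : 0 < `|d| by rewrite normr_gt0.
pose s := Num.min e (`|d| / (1 + `|C|)).
have s0 : 0 < s by rewrite lt_min e0 divr_gt0.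
have se : s <= e by rewrite ge_min lexx.
have sd : s * (1 + `|C|) <= `|d| by rewrite -ler_pdivlMr// ge_min lexx orbT.
have /H : `|s * Num.sg d| <= e.
  by rewrite normrM normr_sg d0 mulr1 gtr0_norm.
rewrite -mulrA -normrEsg exprMn sqr_sg d0 mulr1.
by have := ler_norm C => ? ?; nra.
Qed.

(** * The energy of the input variables near the moments of a tilted product density *)

Section Prior.
Variables (n : nat) (fx : 'I_n -> R -> R) (r tr : 'I_n -> R).
Hypotheses (fx_norm : forall j (r tau : R), 0 < tau -> integrableR (qdens (fx j) r tau))
  (tr0 : forall j, 0 < tr j).
Local Notation px := (fun j => pdens (fx j) (r j) (tr j)).
Local Notation xs := (Evec fx r tr).
Local Notation ts := (Vvec fx r tr).

Lemma FxSP_touch (a1 a2 : 'I_n -> R) :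
  touch (fun h => FxSP fx (fun j => xs j + a1 j * h) (fun j => ts j + a2 j * h))
    (KLvec px fx) (\sum_j ((r j - xs j) / tr j * a1 j - a2 j / (2 * tr j))).
Proof.
apply: (touch_inf (feas := fun j h b => admissible b (fx j) /\
  dmean b = xs j + a1 j * h /\ dvar b = ts j + a2 j * h)
  (val := fun j h b => KL b (fx j)) (c := fun j => KL (px j) (fx j))) => j.
exact: (KL_touch (r j) (fx_norm j) (tr0 j) (a1 j) (a2 j)).
Qed.

Lemma FxSP_value : FxSP fx xs ts = (KLvec px fx)%:E.
Proof.
rewrite -(touch_value (FxSP_touch (fun=> 0) (fun=> 0))).
by congr FxSP; apply/funext => j; rewrite mul0r addr0.
Qed.

Lemma Fx_feasible_pdens : Fx_feasible fx xs ts px.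
Proof. by move=> j; split => //; exact: (admissible_pdens (r j) (fx_norm j) (tr0 j)). Qed.

(** What [KL_gap] leaves besides the gap and the constant [- ln Z]: the moment-dependent part of the
    divergence. Up to a constant it is a minorant of [FxSP], exact at [(xs, ts)]. *)
Definition quad_x (xb tb : 'I_n -> R) : R :=
  \sum_j - ((tb j + (xb j - r j) ^+ 2) / (2 * tr j)).

Lemma KLvec_gap xb tb b : Fx_feasible fx xb tb b ->
  KLvec b fx = KLvec px fx + quad_x xb tb - quad_x xs ts
    + \sum_j gap (fx j) (r j) (tr j) (b j).
Proof.
move=> bf; rewrite /KLvec /quad_x -big_split -sumrB -big_split /=; apply: eq_bigr => j _.
have [_ [bm bv]] := bf j.
rewrite (KL_gap (fx j) (r j) (tr j) (b j)) (KL_gap (fx j) (r j) (tr j) (px j)).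
by rewrite (gap_pdens (r j) (fx_norm j) (tr0 j)) bm bv /Evec /Vvec /pmean /pvar; ring.
Qed.

Lemma FxSP_ge xb tb e : (forall b, Fx_feasible fx xb tb b ->
    e <= \sum_j gap (fx j) (r j) (tr j) (b j)) ->
  ((KLvec px fx + quad_x xb tb - quad_x xs ts + e)%:E <= FxSP fx xb tb)%E.
Proof.
by move=> H; apply: infP_le => b bf; rewrite (KLvec_gap bf) lerD2l H.
Qed.

Lemma FxSP_ge0 xb tb :
  ((KLvec px fx + quad_x xb tb - quad_x xs ts)%:E <= FxSP fx xb tb)%E.
Proof.
rewrite -[X in X%:E]addr0; apply: FxSP_ge => b bf; apply: sumr_ge0 => j _.
by apply: (gap_ge0 (r j) (fx_norm j) (tr0 j)); case: (bf j).
Qed.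

(* The infimum defining [FxSP xb tb] need not be attained, so uniqueness comes
   from the tilted lower bounds rather than from the equality case of Gibbs. *)
Lemma FxSP_le_unique xb tb :
  (FxSP fx xb tb <= (KLvec px fx + quad_x xb tb - quad_x xs ts)%:E)%E ->
  xb = xs /\ tb = ts.
Proof.
move=> Fle.
have key e : (forall b, Fx_feasible fx xb tb b ->
    e <= \sum_j gap (fx j) (r j) (tr j) (b j)) -> e <= 0.
  by move=> /FxSP_ge/le_trans/(_ Fle); rewrite lee_fin gerDl.
(* A bound on one coordinate suffices, because the gaps of the others are nonnegative. The means are
   settled before the variances, so that second moments about [r] then differ only by variances. *)
have one j e : (forall b, admissible b (fx j) -> dmean b = xb j -> dvar b = tb j ->
    e <= gap (fx j) (r j) (tr j) b) -> e <= 0.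
  move=> H; apply: key => b bf; rewrite (bigD1 j)//= -[e]addr0; apply: lerD.
    by have [? [? ?]] := bf j; exact: H.
  apply: sumr_ge0 => l _.
  by apply: (gap_ge0 (r l) (fx_norm l) (tr0 l)); case: (bf l).
have xbE j : xb j = xs j.
  have [e [C [e0 H]]] := gap_tilt_mean (r j) (fx_norm j) (tr0 j).
  apply/eqP; rewrite -subr_eq0; apply/eqP.
  apply: (quadratic_tangent_eq0 (C := C) e0) => lam lame.
  rewrite -subr_le0; apply: (one j) => b bf bm bv.
  by have := H b lam bf lame; rewrite bm.
split; first exact/funext.
apply/funext => j.
have [e [C [e0 H]]] := gap_tilt_second (r j) (fx_norm j) (tr0 j).
apply/eqP; rewrite -subr_eq0; apply/eqP.
apply: (quadratic_tangent_eq0 (C := C) e0) => lam lame.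
rewrite -subr_le0; apply: (one j) => b bf bm bv.
have := H b lam bf lame; rewrite bm bv xbE.
by rewrite /Evec /Vvec /pmean /pvar => ?; lra.
Qed.

Lemma FxSP_minimizer_ae b : Fx_feasible fx xs ts b -> (KLvec b fx)%:E = FxSP fx xs ts ->
  forall j, {ae @leb R, forall y, b j y = px j y}.
Proof.
move=> bf; rewrite FxSP_value => -[]; rewrite (KLvec_gap bf) addrK => bE j.
have g0 l : 0 <= gap (fx l) (r l) (tr l) (b l).
  by apply: (gap_ge0 (r l) (fx_norm l) (tr0 l)); case: (bf l).
apply: (gap_eq0 (fx_norm j) (tr0 j)); first by case: (bf j).
have /eqP : \sum_l gap (fx l) (r l) (tr l) (b l) = 0 by lra.
by rewrite psumr_eq0// => /allP/(_ j); rewrite mem_index_enum => /(_ isT)/eqP.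
Qed.

End Prior.

(** * The energy of the output variables, where only the mean is constrained *)

Section Output.
Variables (m : nat) (fz : 'I_m -> R -> R) (p tp : 'I_m -> R).
Hypotheses (fz_norm : forall i (r tau : R), 0 < tau -> integrableR (qdens (fz i) r tau))
  (tp0 : forall i, 0 < tp i).
Local Notation pz := (fun i => pdens (fz i) (p i) (tp i)).
Local Notation zs := (Evec fz p tp).
Local Notation vs := (Vvec fz p tp).
Local Notation Fz b tq := (\sum_i free_energy (fz i) (b i) (tq i)).

Lemma free_energy_sum (b : 'I_m -> R -> R) (tq : 'I_m -> R) :
  KLvec b fz + Hgauss b tq = Fz b tq.
Proof. by rewrite /KLvec /Hgauss -big_split. Qed.

Lemma FzSPE (zb tq : 'I_m -> R) : FzSP fz zb tq =
  ereal_inf [set (Fz b tq)%:E | b in Fz_feasible fz zb].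
Proof.
congr ereal_inf; apply: eq_imagel => b _.
by rewrite free_energy_sum.
Qed.

Lemma FzSP_touch_mean (a : 'I_m -> R) :
  touch (fun h => FzSP fz (fun i => zs i + a i * h) tp)
    (Fz pz tp) (\sum_i (p i - zs i) / tp i * a i).
Proof.
under eq_fun do rewrite FzSPE.
apply: (touch_inf (feas := fun i h b => admissible b (fz i) /\
  dmean b = zs i + a i * h)
  (val := fun i h b => free_energy (fz i) b (tp i))
  (c := fun i => free_energy (fz i) (pz i) (tp i))) => i.
exact: (free_energy_touch_mean (p i) (fz_norm i) (tp0 i) (a i)).
Qed.

Lemma FzSP_touch_tau (a : 'I_m -> R) :
  touch (fun h => FzSP fz zs (fun i => tp i + a i * h))
    (Fz pz tp) (\sum_i (1 / tp i - vs i / tp i ^+ 2) / 2 * a i).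
Proof.
under eq_fun do rewrite FzSPE.
apply: (touch_inf (feas := fun i h b => admissible b (fz i) /\ dmean b = zs i)
  (val := fun i h b => free_energy (fz i) b (tp i + a i * h))
  (c := fun i => free_energy (fz i) (pz i) (tp i))) => i.
exact: (free_energy_touch_tau (p i) (fz_norm i) (tp0 i) (a i)).
Qed.

Lemma FzSP_value : FzSP fz zs tp = (Fz pz tp)%:E.
Proof.
rewrite -(touch_value (FzSP_touch_mean (fun=> 0))).
by congr FzSP; apply/funext => j; rewrite mul0r addr0.
Qed.

Lemma Fz_feasible_pdens : Fz_feasible fz zs pz.
Proof. by move=> i; split => //; exact: (admissible_pdens (p i) (fz_norm i) (tp0 i)). Qed.

Definition quad_z (zb : 'I_m -> R) : R := \sum_i - ((zb i - p i) ^+ 2 / (2 * tp i)).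

Lemma free_energy_gap zb b : Fz_feasible fz zb b ->
  Fz b tp = Fz pz tp + quad_z zb - quad_z zs + \sum_i gap (fz i) (p i) (tp i) (b i).
Proof.
move=> bf; rewrite /quad_z -big_split -sumrB -big_split /=; apply: eq_bigr => i _.
have [_ bm] := bf i; rewrite /free_energy.
rewrite (KL_gap (fz i) (p i) (tp i) (b i)) (KL_gap (fz i) (p i) (tp i) (pz i)).
by rewrite (gap_pdens (p i) (fz_norm i) (tp0 i)) bm /Evec /pmean; ring.
Qed.

Lemma FzSP_ge zb e : (forall b, Fz_feasible fz zb b ->
    e <= \sum_i gap (fz i) (p i) (tp i) (b i)) ->
  ((Fz pz tp + quad_z zb - quad_z zs + e)%:E <= FzSP fz zb tp)%E.
Proof.
move=> H; rewrite FzSPE; apply: infP_le => b bf.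
by rewrite (free_energy_gap bf) lerD2l H.
Qed.

Lemma FzSP_ge0 zb : ((Fz pz tp + quad_z zb - quad_z zs)%:E <= FzSP fz zb tp)%E.
Proof.
rewrite -[X in X%:E]addr0; apply: FzSP_ge => b bf; apply: sumr_ge0 => i _.
by apply: (gap_ge0 (p i) (fz_norm i) (tp0 i)); case: (bf i).
Qed.

Lemma FzSP_le_unique zb :
  (FzSP fz zb tp <= (Fz pz tp + quad_z zb - quad_z zs)%:E)%E -> zb = zs.
Proof.
move=> Fle; apply/funext => i.
have [e [C [e0 H]]] := gap_tilt_mean (p i) (fz_norm i) (tp0 i).
apply/eqP; rewrite -subr_eq0; apply/eqP.
apply: (quadratic_tangent_eq0 (C := C) e0) => lam lame.
rewrite -subr_le0; set x := (X in X <= 0).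
suff : ((Fz pz tp + quad_z zb - quad_z zs + x)%:E <= FzSP fz zb tp)%E.
  by move=> /le_trans/(_ Fle); rewrite lee_fin gerDl.
apply: FzSP_ge => b bf; rewrite (bigD1 i)//= -[x]addr0; apply: lerD.
  by have [bi bm] := bf i; have := H _ lam bi lame; rewrite bm.
apply: sumr_ge0 => l _.
by apply: (gap_ge0 (p l) (fz_norm l) (tp0 l)); case: (bf l).
Qed.

Lemma FzSP_minimizer_ae b : Fz_feasible fz zs b ->
  (KLvec b fz + Hgauss b tp)%:E = FzSP fz zs tp ->
  forall i, {ae @leb R, forall y, b i y = pz i y}.
Proof.
move=> bf; rewrite FzSP_value free_energy_sum => -[].
rewrite (free_energy_gap bf) addrK => bE i.
have g0 l : 0 <= gap (fz l) (p l) (tp l) (b l).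
  by apply: (gap_ge0 (p l) (fz_norm l) (tp0 l)); case: (bf l).
apply: (gap_eq0 (fz_norm i) (tp0 i)); first by case: (bf i).
have /eqP : \sum_l gap (fz l) (p l) (tp l) (b l) = 0 by lra.
by rewrite psumr_eq0// => /allP/(_ i); rewrite mem_index_enum => /(_ isT)/eqP.
Qed.

End Output.

(** Any reference tilt, here [r = 0] and [tau = 1], bounds the infimum below; [exists_admissible]
    bounds it above. *)
Lemma FxSP_fin n (fx : 'I_n -> R -> R) xb tb :
  (forall j, measurable_fun setT (fx j)) ->
  (forall j (r tau : R), 0 < tau -> integrableR (qdens (fx j) r tau)) ->
  (forall j, 0 < tb j) -> exists c : R, FxSP fx xb tb = c%:E.
Proof.
move=> fx_meas fx_norm tb0.
have /choice[b bP] : forall j, exists b,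
    admissible b (fx j) /\ dmean b = xb j /\ dvar b = tb j.
  by move=> j; have [b [? ? ?]] := exists_admissible (fx_meas j) (xb j) (tb0 j); exists b.
have lb := FxSP_ge0 (fun=> 0) fx_norm (fun=> ltr01) xb tb.
have ub : (FxSP fx xb tb <= (KLvec b fx)%:E)%E.
  by apply: ereal_inf_lbound; exists b.
by move: lb ub; case: (FxSP fx xb tb) => [c||] //; exists c.
Qed.

End VectorTouch.

(** * The GAMP iteration *)

Section Iteration.
Context {R : realType}.
Variables (m n : nat) (A : 'M[R]_(m, n)).

Lemma mv_adjoint (B : 'M[R]_(m, n)) (y : 'I_m -> R) (v : 'I_n -> R) :
  \sum_i y i * mv B v i = \sum_j mtv B y j * v j.
Proof.
rewrite /mv /mtv; under eq_bigr do rewrite mulr_sumr.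
rewrite exchange_big /=; apply: eq_bigr => j _.
by rewrite mulr_suml; apply: eq_bigr => i _; ring.
Qed.

Lemma mv_perturb (B : 'M[R]_(m, n)) (v : 'I_n -> R) j h i :
  mv B (fun l => v l + (l == j)%:R * h) i = mv B v i + B i j * h.
Proof.
rewrite /mv; under eq_bigr do rewrite mulrDr.
rewrite big_split /=; congr (_ + _); rewrite (bigD1 j)//= eqxx mul1r.
rewrite big1 ?addr0// => l /negPf ->.
by rewrite mul0r mulr0.
Qed.

Lemma perturbE k (v : 'I_k -> R) j h :
  (fun l => if l == j then v l + h else v l) = (fun l => v l + (l == j)%:R * h).
Proof. by apply/funext => l; case: eqP; rewrite ?mul1r ?mul0r ?addr0. Qed.

Lemma addeEFin_le (u : \bar R) (a c : R) :
  (u + a%:E <= c%:E)%E -> (u <= (c - a)%:E)%E.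
Proof. by rewrite EFinB leeBrDr. Qed.

Variables (fx : 'I_n -> R -> R) (fz : 'I_m -> R -> R).
Hypotheses (fx_norm : forall j (r tau : R), 0 < tau -> integrableR (qdens (fx j) r tau))
  (fz_norm : forall i (p tau : R), 0 < tau -> integrableR (qdens (fz i) p tau)).

Section InputStep.
Variables (x r tr : 'I_n -> R) (z tp s ts : 'I_m -> R) (cz : R).
Hypotheses (tr0 : forall j, 0 < tr j) (FzE : FzSP fz z tp = cz%:E)
  (trE : tr = (fun j => 1 / mtv (Smat A) ts j))
  (rE : r = (fun j => x j + tr j * mtv A s j)).

Let K (xb tb : 'I_n -> R) := cz + \sum_i s i * (z i - mv A xb i) +
  1 / 2 * \sum_i ts i * mv (Smat A) tb i + 1 / 2 * \sum_j (xb j - x j) ^+ 2 / tr j.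

Let objxE xb tb :
  objx A fx fz x z tp s ts tr xb tb = (FxSP fx xb tb + (K xb tb)%:E)%E.
Proof. by rewrite /objx /LSP /FSP FzE /K !EFinD !addeA. Qed.

(* Completing the square: the damping terms of the objective are the linear
   parts of [- quad_x], up to a constant. *)
Let K_quad xb tb : K xb tb + quad_x r tr xb tb =
  cz + \sum_i s i * z i +
  \sum_j - (mtv A s j * x j + tr j * mtv A s j ^+ 2 / 2).
Proof.
rewrite /K; under eq_bigr do rewrite mulrBr; rewrite sumrB.
rewrite !mv_adjoint !mulr_sumr -!addrA; congr (_ + (_ + _)).
rewrite /quad_x -sumrN -!big_split /=; apply: eq_bigr => j _.
have trn : tr j != 0 by exact: lt0r_neq0.
have -> : mtv (Smat A) ts j = (tr j)^-1 by rewrite trE div1r invrK.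
by rewrite rE; field.
Qed.

Lemma objx_min (xb tb : 'I_n -> R) :
  (objx A fx fz x z tp s ts tr (Evec fx r tr) (Vvec fx r tr)
    <= objx A fx fz x z tp s ts tr xb tb)%E.
Proof.
rewrite !objxE (FxSP_value r fx_norm tr0).
apply: (le_trans _ (leeD (FxSP_ge0 r fx_norm tr0 xb tb) (lexx _))).
have := K_quad xb tb; have := K_quad (Evec fx r tr) (Vvec fx r tr).
by rewrite -!EFinD lee_fin => ? ?; lra.
Qed.

Lemma objx_unique (xb tb : 'I_n -> R) :
  (objx A fx fz x z tp s ts tr xb tb <=
   objx A fx fz x z tp s ts tr (Evec fx r tr) (Vvec fx r tr))%E ->
  xb = Evec fx r tr /\ tb = Vvec fx r tr.
Proof.
rewrite !objxE (FxSP_value r fx_norm tr0) -EFinD => /addeEFin_le Fle.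
apply: (FxSP_le_unique fx_norm tr0); apply: (le_trans Fle).
have := K_quad xb tb; have := K_quad (Evec fx r tr) (Vvec fx r tr).
by rewrite lee_fin => ? ?; lra.
Qed.

End InputStep.

Section OutputStep.
Variables (x tx : 'I_n -> R) (p tp s : 'I_m -> R) (cx : R).
Hypotheses (tp0 : forall i, 0 < tp i) (FxE : FxSP fx x tx = cx%:E)
  (pE : p = (fun i => mv A x i - s i * tp i)).

Let K (zb : 'I_m -> R) := cx + \sum_i s i * (zb i - mv A x i) +
  1 / 2 * \sum_i (zb i - mv A x i) ^+ 2 / tp i.

Let objzE zb : objz A fx fz x tx tp s zb = (FzSP fz zb tp + (K zb)%:E)%E.
Proof. by rewrite /objz /LSP /FSP FxE /K !EFinD [(cx%:E + _)%E]addeC !addeA. Qed.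

Let K_quad zb : K zb + quad_z p tp zb = cx + \sum_i - (s i ^+ 2 * tp i / 2).
Proof.
(* The term [s * tp] subtracted in [p] is what completes the square, leaving a constant in [zb]. *)
rewrite /K mulr_sumr /quad_z -!addrA; congr (_ + _).
rewrite -!big_split /=; apply: eq_bigr => i _.
have tpn : tp i != 0 by exact: lt0r_neq0.
by rewrite pE; field.
Qed.

Lemma objz_min (zb : 'I_m -> R) :
  (objz A fx fz x tx tp s (Evec fz p tp) <= objz A fx fz x tx tp s zb)%E.
Proof.
rewrite !objzE (FzSP_value p fz_norm tp0).
apply: (le_trans _ (leeD (FzSP_ge0 p fz_norm tp0 zb) (lexx _))).
have := K_quad zb; have := K_quad (Evec fz p tp).
by rewrite -!EFinD lee_fin => ? ?; lra.
Qed.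

Lemma objz_unique (zb : 'I_m -> R) :
  (objz A fx fz x tx tp s zb <= objz A fx fz x tx tp s (Evec fz p tp))%E ->
  zb = Evec fz p tp.
Proof.
rewrite !objzE (FzSP_value p fz_norm tp0) -EFinD => /addeEFin_le Fle.
apply: (FzSP_le_unique fz_norm tp0); apply: (le_trans Fle).
have := K_quad zb; have := K_quad (Evec fz p tp).
by rewrite lee_fin => ? ?; lra.
Qed.

Lemma LSP_derive_tau (s' : 'I_m -> R) i :
  let G := fun tq => fine (LSP A fx fz x (Evec fz p tp) tx tq s') in
  pderivable G tp i /\
  1 / tp i - Vvec fz p tp i / tp i ^+ 2 = 2 * pderiv G tp i.
Proof.
move=> G; have t := touchD (touchD (touch_fin (is_derive0_cst cx))
    (FzSP_touch_tau p fz_norm tp0 (fun l => (l == i)%:R)))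
  (touch_fin (is_derive0_cst (\sum_i s' i * (Evec fz p tp i - mv A x i)))).
have [] := touch_derive t; rewrite -FxE /= => dG dGE.
have sliceE : slice G tp i = fun h =>
    fine (FxSP fx x tx + FzSP fz (Evec fz p tp)
      (fun l => (tp l + (l == i)%:R * h)%R) +
      (\sum_i s' i * (Evec fz p tp i - mv A x i))%R%:E)%E.
  by apply/funext => h; rewrite /slice perturbE.
rewrite /pderivable /pderiv sliceE; split => //.
rewrite dGE add0r addr0 (bigD1 i)//= eqxx mulr1 big1 => [|l /negPf ->].
  by rewrite addr0; field; exact: lt0r_neq0.
by rewrite mulr0.
Qed.

End OutputStep.

Section FixedPoint.
Variables (xh tx tr r : 'I_n -> R) (sh tp p zh : 'I_m -> R).
Hypotheses (tp0 : forall i, 0 < tp i) (tr0 : forall j, 0 < tr j)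
  (tpE : tp = mv (Smat A) tx) (zhE : zh = Evec fz p tp)
  (shE : sh = (fun i => (zh i - p i) / tp i))
  (trE : tr = (fun j =>
     1 / mtv (Smat A) (fun i => 1 / tp i - Vvec fz p tp i / tp i ^+ 2) j))
  (rE : r = (fun j => xh j + tr j * mtv A sh j))
  (xhE : Evec fx r tr = xh) (txE : Vvec fx r tr = tx).

Let lin xb zb := \sum_i sh i * (zb i - mv A xb i).

Let slice_touch k (G : ('I_k -> R) -> \bar R) v j c :
  touch (fun h => G (fun l => v l + (l == j)%:R * h)) c 0 ->
  pderivable (fun w => fine (G w)) v j /\ pderiv (fun w => fine (G w)) v j = 0.
Proof.
move=> /touch_derive[dG dGE]; rewrite /pderivable /pderiv.
have -> : slice (fun w => fine (G w)) v j =
    fun h => fine (G (fun l => v l + (l == j)%:R * h)).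
  by apply/funext => h; rewrite /slice perturbE.
by [].
Qed.

Let sum_delta k (F : 'I_k -> R) j : \sum_l F l * (l == j)%:R = F j.
Proof.
rewrite (bigD1 j)//= eqxx mulr1 big1 ?addr0// => l /negPf ->.
by rewrite mulr0.
Qed.

(** Each slope cancels against one GAMP relation: in [xb], [(r - xh) / tr] is the adjoint of [A] at
    [sh]; in [zb], [(p - zh) / tp = - sh]; in [tb], the slope [- 1 / (2 * tr)] of the input energy
    meets half of the transpose of [S] applied to [tau_s]. *)
Lemma fixed_point_critical :
  let G := fun xb zb tb => fine (LSP A fx fz xb zb tb (mv (Smat A) tb) sh) in
  [/\ forall j, pderivable (fun xb => G xb zh tx) xh j /\
        pderiv (fun xb => G xb zh tx) xh j = 0,
      forall i, pderivable (fun zb => G xh zb tx) zh i /\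
        pderiv (fun zb => G xh zb tx) zh i = 0 &
      forall j, pderivable (fun tb => G xh zh tb) tx j /\
        pderiv (fun tb => G xh zh tb) tx j = 0].
Proof.
move=> G.
have Fx a1 a2 := FxSP_touch r fx_norm tr0 a1 a2.
have Fzm a := FzSP_touch_mean p fz_norm tp0 a.
have Fzt a := FzSP_touch_tau p fz_norm tp0 a.
rewrite xhE txE in Fx; rewrite -zhE in Fzm Fzt.
have fin c := touch_fin (is_derive0_cst c : is_derive (0 : R) 1 (fun=> c) 0).
have [cx Fx0] : exists c, FxSP fx xh tx = c%:E.
  by rewrite -xhE -txE; eexists; exact: (FxSP_value r fx_norm tr0).
have [cz Fz0] : exists c, FzSP fz zh tp = c%:E.
  by rewrite zhE; eexists; exact: (FzSP_value p fz_norm tp0).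
split => [j|i|j].
- apply: (slice_touch (G := fun xb => LSP A fx fz xb zh tx (mv (Smat A) tx) sh)).
  have dlin : is_derive (0 : R) 1
      (fun h => lin (fun l => xh l + (l == j)%:R * h) zh) (- mtv A sh j).
    apply: (is_derive0_eq (is_derive0_quadratic (lin xh zh) (- mtv A sh j) 0)) => // h.
    rewrite /lin mul0r addr0 /mtv mulNr mulr_suml -sumrN -big_split /=.
    by apply: eq_bigr => i _; rewrite mv_perturb; ring.
  apply: (touch_eq (touchD (touchD (Fx (fun l => (l == j)%:R) (fun=> 0)) (fin cz))
    (touch_fin dlin))) => [h||]; last first.
  + rewrite addr0; under eq_bigr do rewrite mul0r subr0.
    rewrite sum_delta rE /=.
    have := lt0r_neq0 (tr0 j); move: (tr j) (mtv A sh j) => t a tn.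
    by field.
  + by [].
  + rewrite -Fz0 /LSP /FSP -tpE.
    by congr (FxSP _ _ _ + _ + _)%E; apply/funext => l; rewrite mul0r addr0.
- apply: (slice_touch (G := fun zb => LSP A fx fz xh zb tx (mv (Smat A) tx) sh)).
  have dlin : is_derive (0 : R) 1
      (fun h => lin xh (fun l => zh l + (l == i)%:R * h)) (sh i).
    apply: (is_derive0_eq (is_derive0_quadratic (lin xh zh) (sh i) 0)) => // h.
    rewrite /lin mul0r addr0 -{1}(sum_delta sh i) mulr_suml -big_split /=.
    by apply: eq_bigr => l _; ring.
  apply: (touch_eq (touchD (touchD (fin cx) (Fzm (fun l => (l == i)%:R)))
    (touch_fin dlin))) => [h||]; last first.
  + by rewrite add0r sum_delta shE; field; exact: lt0r_neq0.
  + by [].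
  + by rewrite -Fx0 /LSP /FSP -tpE.
- apply: (slice_touch (G := fun tb => LSP A fx fz xh zh tb (mv (Smat A) tb) sh)).
  (* Moving [tb j] also moves [tp] along column [j] of [S], so both energies contribute. *)
  apply: (touch_eq (touchD (touchD (Fx (fun=> 0) (fun l => (l == j)%:R))
    (Fzt (fun i => Smat A i j))) (fin (lin xh zh)))) => [h||]; last first.
  + rewrite addr0.
    have -> : \sum_l ((r l - xh l) / tr l * 0 - (l == j)%:R / (2 * tr l)) =
        \sum_l (- (2 * tr l)^-1) * (l == j)%:R by apply: eq_bigr => l _; ring.
    rewrite sum_delta.
    have -> : \sum_i (1 / tp i - Vvec fz p tp i / tp i ^+ 2) / 2 * Smat A i j =
        2^-1 * mtv (Smat A) (fun i => 1 / tp i - Vvec fz p tp i / tp i ^+ 2) j.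
      by rewrite /mtv mulr_sumr; apply: eq_bigr => i _; ring.
    by rewrite {1}trE div1r invfM invrK; ring.
  + by [].
  + rewrite /LSP /FSP; rewrite -/(lin xh zh); congr (_ + _ + _)%E.
    * by congr FxSP; apply/funext => l; rewrite mul0r addr0.
    * by congr FzSP; apply/funext => i; rewrite mv_perturb -tpE.
Qed.

End FixedPoint.

End Iteration.

Unset Implicit Arguments.

Theorem theorem2 (R : realType) (m n : nat) (A : 'M[R]_(m, n))
  (fx : 'I_n -> R -> R) (fz : 'I_m -> R -> R)
  (fx_meas : forall j, measurable_fun setT (fx j))
  (fz_meas : forall i, measurable_fun setT (fz i))
  (fx_norm : forall j (r tau : R), 0 < tau -> integrableR (qdens (fx j) r tau))
  (fz_norm : forall i (p tau : R), 0 < tau -> integrableR (qdens (fz i) p tau))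
  (x taux taur r : nat -> 'I_n -> R) (taup p z tauz s taus : nat -> 'I_m -> R)
  (Htaux0 : forall j, 0 < taux 0%N j)
  (Htaup : forall t, taup t = mv (Smat A) (taux t))
  (Hp : forall t, p t = (fun i => mv A (x t) i - sprev s t i * taup t i))
  (Hz : forall t, z t = Evec fz (p t) (taup t))
  (Htauz : forall t, tauz t = Vvec fz (p t) (taup t))
  (Hs : forall t, s t = (fun i => (z t i - p t i) / taup t i))
  (Htaus : forall t, taus t = (fun i => 1 / taup t i - tauz t i / taup t i ^+ 2))
  (Htaur : forall t, taur t = (fun j => 1 / mtv (Smat A) (taus t) j))
  (Hr : forall t, r t = (fun j => x t j + taur t j * mtv A (s t) j))
  (Hx : forall t, x t.+1 = Evec fx (r t) (taur t))
  (Htaux : forall t, taux t.+1 = Vvec fx (r t) (taur t))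
  (Htaup_pos : forall t i, 0 < taup t i)
  (Htaur_pos : forall t j, 0 < taur t j) :
  (forall t : nat,
    (* (i) *)
    ((forall xb tb : 'I_n -> R, (forall j, 0 < tb j) ->
        (objx A fx fz (x t) (z t) (taup t) (s t) (taus t) (taur t)
           (x t.+1) (taux t.+1)
         <= objx A fx fz (x t) (z t) (taup t) (s t) (taus t) (taur t) xb tb)%E) /\
     (forall xb tb : 'I_n -> R, (forall j, 0 < tb j) ->
        (objx A fx fz (x t) (z t) (taup t) (s t) (taus t) (taur t) xb tb
         <= objx A fx fz (x t) (z t) (taup t) (s t) (taus t) (taur t)
              (x t.+1) (taux t.+1))%E ->
        xb = x t.+1 /\ tb = taux t.+1)) /\
    (* (ii) *)
    (taup t = mv (Smat A) (taux t) /\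
     (forall zb : 'I_m -> R,
        (objz A fx fz (x t) (taux t) (taup t) (sprev s t) (z t)
         <= objz A fx fz (x t) (taux t) (taup t) (sprev s t) zb)%E) /\
     (forall zb : 'I_m -> R,
        (objz A fx fz (x t) (taux t) (taup t) (sprev s t) zb
         <= objz A fx fz (x t) (taux t) (taup t) (sprev s t) (z t))%E ->
        zb = z t) /\
     s t = (fun i => sprev s t i + (z t i - mv A (x t) i) / taup t i) /\
     (forall i,
        pderivable (fun tp => fine (LSP A fx fz (x t) (z t) (taux t) tp (s t)))
          (taup t) i /\
        taus t i = 2 * pderiv
          (fun tp => fine (LSP A fx fz (x t) (z t) (taux t) tp (s t))) (taup t) i)))
  /\
  (forall (xh tx tr rh : 'I_n -> R) (sh tp ph zh tz s' ts : 'I_m -> R),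
    (forall j, 0 < tx j) -> (forall i, 0 < tp i) -> (forall j, 0 < tr j) ->
    sp_fixed_point A fx fz xh tx sh tp ph zh tz s' ts tr rh ->
    (* critical point of min F_SP s.t. z = A x, taup = S taux *)
    zh = mv A xh /\ tp = mv (Smat A) tx /\
    (let G := fun (xb : 'I_n -> R) (zb : 'I_m -> R) (tb : 'I_n -> R) =>
                fine (LSP A fx fz xb zb tb (mv (Smat A) tb) sh) in
     (forall j, pderivable (fun xb => G xb zh tx) xh j /\
                pderiv (fun xb => G xb zh tx) xh j = 0) /\
     (forall i, pderivable (fun zb => G xh zb tx) zh i /\
                pderiv (fun zb => G xh zb tx) zh i = 0) /\
     (forall j, pderivable (fun tb => G xh zh tb) tx j /\
                pderiv (fun tb => G xh zh tb) tx j = 0)) /\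
    (* the minimizing densities *)
    (let bx := fun j => pdens (fx j) (rh j) (tr j) in
     Fx_feasible fx xh tx bx /\ (KLvec bx fx)%:E = FxSP fx xh tx /\
     (forall b, Fx_feasible fx xh tx b -> (KLvec b fx)%:E = FxSP fx xh tx ->
        forall j, {ae @leb R, forall y, b j y = bx j y})) /\
    (let bz := fun i => pdens (fz i) (ph i) (tp i) in
     Fz_feasible fz zh bz /\ (KLvec bz fz + Hgauss bz tp)%:E = FzSP fz zh tp /\
     (forall b, Fz_feasible fz zh b ->
        (KLvec b fz + Hgauss b tp)%:E = FzSP fz zh tp ->
        forall i, {ae @leb R, forall y, b i y = bz i y}))).
Proof.
have zE t : FzSP fz (z t) (taup t) =
    (\sum_i free_energy (fz i) (pdens (fz i) (p t i) (taup t i)) (taup t i))%:E.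
  by rewrite Hz; exact: (FzSP_value (p t) fz_norm (Htaup_pos t)).
have xE t : exists c, FxSP fx (x t) (taux t) = c%:E.
  (* Only the arbitrary initial pair needs the construction of feasible densities; later pairs are
     moments of a tilted density. *)
  case: t => [|t]; first exact: FxSP_fin.
  by rewrite Hx Htaux; eexists; exact: (FxSP_value (r t) fx_norm (Htaur_pos t)).
split=> [t|xh tx tr rh sh tp ph zh tz s' ts tx0 tp0 tr0].
  split.
    rewrite Hx Htaux; split=> xb tb _.
      exact: (objx_min fx_norm (Htaur_pos t) (zE t) (Htaur t) (Hr t)).
    exact: (objx_unique fx_norm (Htaur_pos t) (zE t) (Htaur t) (Hr t)).
  have [cx FxE] := xE t.
  split; first exact: Htaup.
  split=> [zb|].
    by rewrite Hz; exact: (objz_min fz_norm (Htaup_pos t) FxE (Hp t)).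
  split=> [zb|].
    by rewrite Hz; exact: (objz_unique fz_norm (Htaup_pos t) FxE (Hp t)).
  split=> [|i].
    rewrite Hs; apply/funext => i; rewrite Hp.
    by have := lt0r_neq0 (Htaup_pos t i) => tn; field.
  have [dG dGE] := LSP_derive_tau A fz_norm (p t) (Htaup_pos t) FxE (s t) i.
  by rewrite Hz Htaus Htauz.
move=> [tpE [phE [zhE [tzE [s'E [tsE [trE [rhE [ss [xhE txE]]]]]]]]]].
rewrite ss in s'E rhE; rewrite tsE tzE in trE.
split.
  (* At a fixed point the same [sh] enters [p] and is returned by the update, so it cancels and only
     [zh = A xh] remains. *)
  apply/funext => i; have := congr1 (fun v => v i) s'E; rewrite phE /= => shi.
  have tn := lt0r_neq0 (tp0 i).
  have : sh i * tp i = zh i - (mv A xh i - sh i * tp i) by rewrite {1}shi divfK.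
  by lra.
split; first exact: tpE.
split.
  have [Gx Gz Gt] :=
    fixed_point_critical fx_norm fz_norm tp0 tr0 tpE zhE s'E trE rhE xhE txE.
  by split.
split.
  split; first by rewrite -xhE -txE; exact: Fx_feasible_pdens.
  rewrite -xhE -txE; split; first by rewrite FxSP_value.
  exact: FxSP_minimizer_ae.
split; first by rewrite zhE; exact: Fz_feasible_pdens.
rewrite zhE; split; first by rewrite FzSP_value// free_energy_sum.
exact: FzSP_minimizer_ae.
Qed.
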